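(* Let $\ell$ be a rational prime, $X$ a connected (finite) graph, and $S=\{s_1,\dots,s_t\}$ an orientation of $X$. Let $G$ be an infinite pro-$\ell$ group with lower central $\ell$-series $(G_n)_{n\ge0}$ and put $G^{(n)}=G/G_n$. Let $g_1,\dots,g_k$ with $k\le t$ be a set of topological generators of $G$, and let $\alpha:S\to G$ be a voltage assignment with $\alpha(s_i)=g_i$ for $i\le k$ and $\alpha(s_i)\in G$ arbitrary for $i>k$. Suppose given a $\mathbb{Z}_\ell$-tower $X=X_0\leftarrow X_1\leftarrow\cdots\leftarrow X_n\leftarrow\cdots$ above $X$; put $\Gamma^{(m)}=\mathrm{Gal}(X_m/X)\simeq\mathbb{Z}/\ell^m\mathbb{Z}$ and $\Gamma=\varprojlim_m\Gamma^{(m)}\simeq\mathbb{Z}_\ell$, and let $\beta:S\to\Gamma$ be a voltage assignment such that $X_m=X(\Gamma^{(m)},S,\beta_{/m})$ for all $m$, where $\beta_{/m}$ is the composite of $\beta$ with $\Gamma\to\Gamma^{(m)}$. Let $\gamma:S\to G\times\Gamma$ be $\gamma(s)=(\alpha(s),\beta(s))$, let $\gamma_{n,m}$ be the composite of $\gamma$ with the quotient map $G\times\Gamma\to G^{(n)}\times\Gamma^{(m)}$, and set $Y_{n,m}=X(G^{(n)}\times\Gamma^{(m)},S,\gamma_{n,m})$ and $Y_n=Y_{n,0}$. Assume that 1. the group $G$ is uniform of dimension $d$; 2. the graph $Y_{n,m}$ is connected for all $n,m\ge 0$; 3. $\mu_0=0$; where, for $n\ge 0$, $\mu_n$ and $\lambda_n$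 denote the Iwasawa $\mu$- and $\lambda$-invariants of the $\mathbb{Z}_\ell$-tower $$Y_n=Y_{n,0}\leftarrow Y_{n,1}\leftarrow Y_{n,2}\leftarrow\cdots\leftarrow Y_{n,m}\leftarrow\cdots$$ above $Y_n$. Write $\lambda=\lambda_0$. Then for all $n\ge 0$ one has $\mu_n=0$ and $$\lambda_n=\ell^{dn}(\lambda+1)-1.$$
   Context: Graphs (in the sense of Serre). A graph $X$ consists of a finite set of vertices $V_X$, a finite set of directed edges $\mathbf{E}_X$, an incidence map $e\mapsto (o(e),t(e))\in V_X\times V_X$ and an inversion $e\mapsto\bar e$ on $\mathbf{E}_X$ with $\bar e\ne e$, $\bar{\bar e}=e$, $o(\bar e)=t(e)$, $t(\bar e)=o(e)$. Loops and parallel edges are allowed; all graphs are finite. For $v\in V_X$, $\mathbf{E}_{X,v}=\{e\in\mathbf{E}_X:o(e)=v\}$. A morphism $f:Y\to X$ is a pair of maps on vertices and directed edges commuting with $o$, $t$ and inversion. It is a cover if it is surjective on vertices and restricts to bijections $\mathbf{E}_{Y,w}\to\mathbf{E}_{X,f(w)}$ for all $w\in V_Y$. A cover is Galois if $Y$ is connected and $\mathrm{Aut}_f(Y/X)=\{\sigma\in\mathrm{Aut}(Y):f\circ\sigma=f\}$, then denoted $\mathrm{Gal}(Y/X)$, acts transitively on each fiber of $f$ over a vertex of $X$. $\mathbb{Z}_\ell$-towers and Iwasawa invariants. A $\mathbb{Z}_\ell$-tower above a connected graph $X$ is a sequence of covers of connected graphs $X=X_0\leftarrow X_1\leftarrow\cdots$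 such that each composite $X_n\to X$ ($n\geq 1$) is Galois with group isomorphic to $\mathbb{Z}/\ell^n\mathbb{Z}$. It is a known theorem that (when the Euler characteristic $|V_X|-|E_X|$ of the base is nonzero, where $E_X$ is the set of undirected edges) there are unique integers $\mu\ge0,\lambda\ge0,\nu$ with $\mathrm{ord}_\ell(\kappa_n)=\mu\ell^n+\lambda n+\nu$ for all large $n$, where $\kappa_n$ is the number of spanning trees of $X_n$; $\mu$ and $\lambda$ are the Iwasawa invariants of the tower. Voltage assignments. An orientation of $X$ is a subset $S\subseteq\mathbf{E}_X$ with $S\cap\overline S=\varnothing$ and $\mathbf{E}_X=S\cup\overline S$. A voltage assignment is a function $\alpha:S\to H$ to a group $H$, extended to $\mathbf{E}_X$ by $\alpha(\bar s)=\alpha(s)^{-1}$. For $H$ finite, the graph $X(H,S,\alpha)$ has vertex set $V_X\times H$ and directed edge set $\mathbf{E}_X\times H$, where $(e,\sigma)$ goes from $(o(e),\sigma)$ to $(t(e),\sigma\alpha(e))$ and $\overline{(e,\sigma)}=(\bar e,\sigma\alpha(e))$. It maps to $X$ by projection on the first component, and a surjective homomorphism $q:H\to H'$ induces a cover $X(H,S,\alpha)\to X(H',S,q\circ\alpha)$, $(v,\sigma)\mapsto(v,q(\sigma))$, $(e,\sigma)\mapsto(e,q(\sigma))$; the maps in the towers above are those induced by the natural quotient maps. Uniform groups. For a pro-$\ell$ group $G$, the lower central $\ell$-series is $G_0=G$, $G_{n+1}=(G_n)^\ell[G_n,G]$, where for a group $H$, $H^\ell$ denotes the subgroup generated by $\ell$-th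 powers and subgroups are understood as closed subgroups. Elements of $G$ are topological generators if the closure of the subgroup they generate is $G$. $G$ is finitely generated if it has a finite set of topological generators. $G$ is uniform if (1) $G$ is finitely generated; (2) $[G,G]\subseteq G^\ell$ if $\ell$ is odd, and $[G,G]\subseteq G^4$ if $\ell=2$; (3) $[G_n:G_{n+1}]=[G:G_1]$ for all $n\ge1$. The dimension of a uniform $G$ is the integer $d\geq 1$ with $[G:G_1]=\ell^d$. *)

(* Defs.v *)
From HB Require Import structures.
From mathcomp Require Import all_boot all_order all_algebra all_fingroup all_solvable.
From mathcomp Require Import all_classical topology.
From mathcomp Require Import zify.

Set Implicit Arguments.
Unset Strict Implicit.
Unset Printing Implicit Defensive.

Local Open Scope group_scope.

Record graph := Graph {
  vert : finType;
  edge : finType;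
  org : edge -> vert;
  tgt : edge -> vert;
  einv : edge -> edge;
  einv_neq : forall e, einv e != e;
  einvK : involutive einv;
  org_inv : forall e, org (einv e) = tgt e;
  tgt_inv : forall e, tgt (einv e) = org e }.

Section Graph.
Variable X : graph.
Implicit Types (v w : vert X) (e : edge X).

Definition star v : {set edge X} := [set e | org e == v]%SET.

Definition adj (T : {set edge X}) : rel (vert X) :=
  fun v w => [exists e in T, (org e == v) && (tgt e == w)].

Definition spans_connected (T : {set edge X}) : Prop :=
  forall v w, connect (adj T) v w.

Definition connected_graph : Prop :=
  (0 < #|vert X|)%N /\ spans_connected [set: edge X]%SET.

(* A circuit is a nonempty closed path without backtracking visiting each of
   its vertices once; loops and pairs of parallel edges are circuits. *)
Definition circuit (p : seq (edge X)) : Prop :=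
  [/\ p <> [::],
      path.cycle (fun e e' => (tgt e == org e') && (e' != einv e)) p
    & uniq (map (@org X) p)].

(* A spanning tree, as the set of its directed edges. *)
Definition spanning_tree (T : {set edge X}) : Prop :=
  [/\ forall e, e \in T -> einv e \in T,
      spans_connected T
    & forall p, circuit p -> ~ {subset p <= T}].

Definition num_spanning_trees : nat :=
  #|[set T : {set edge X} | `[< spanning_tree T >]]%SET|.

End Graph.

Record ghom (Y X : graph) := GHom {
  vmap : vert Y -> vert X;
  emap : edge Y -> edge X;
  emap_org : forall e, org (emap e) = vmap (org e);
  emap_tgt : forall e, tgt (emap e) = vmap (tgt e);
  emap_inv : forall e, emap (einv e) = einv (emap e) }.

Definition ghom_id (X : graph) : ghom X X :=
  @GHom X X id id (fun=> erefl) (fun=> erefl) (fun=> erefl).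

Section Comp.
Variables (Z Y X : graph) (f : ghom Y X) (h : ghom Z Y).

Fact ghom_comp_org e : org (emap f (emap h e)) = vmap f (vmap h (org e)).
Proof. by rewrite !emap_org. Qed.
Fact ghom_comp_tgt e : tgt (emap f (emap h e)) = vmap f (vmap h (tgt e)).
Proof. by rewrite !emap_tgt. Qed.
Fact ghom_comp_inv e : emap f (emap h (einv e)) = einv (emap f (emap h e)).
Proof. by rewrite !emap_inv. Qed.

Definition ghom_comp : ghom Z X :=
  @GHom Z X (vmap f \o vmap h) (emap f \o emap h)
    ghom_comp_org ghom_comp_tgt ghom_comp_inv.

End Comp.

Definition giso (Y X : graph) (f : ghom Y X) : Prop :=
  bijective (vmap f) /\ bijective (emap f).

Definition cover (Y X : graph) (f : ghom Y X) : Prop :=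
  (forall v, exists w, vmap f w = v) /\
  (forall w, {in star w &, injective (emap f)} /\
             emap f @: star w = star (vmap f w)).

Section Gal.
Variables (Y X : graph) (f : ghom Y X).

(* The product of permutations is [(s * t) x = t (s x)], the opposite of
   composition; this is harmless for the abelian groups of a Zl-tower. *)
Definition gal : {set {perm vert Y} * {perm edge Y}} :=
  [set s : {perm vert Y} * {perm edge Y} | [forall e, [&& org (s.2 e) == s.1 (org e),
                          tgt (s.2 e) == s.1 (tgt e),
                          s.2 (einv e) == einv (s.2 e)
                        & emap f (s.2 e) == emap f e]] &&
           [forall v, vmap f (s.1 v) == vmap f v]]%SET.

Lemma galP (s : {perm vert Y} * {perm edge Y}) : reflect
  [/\ forall e, org (s.2 e) = s.1 (org e), forall e, tgt (s.2 e) = s.1 (tgt e),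
      forall e, s.2 (einv e) = einv (s.2 e),
      forall e, emap f (s.2 e) = emap f e
    & forall v, vmap f (s.1 v) = vmap f v] (s \in gal).
Proof.
rewrite inE; apply: (iffP andP) => [[/forallP h1 /forallP h2]|[h1 h2 h3 h4 h5]].
  by split=> [e|e|e|e|v]; try (by case/and4P: (h1 e) => *; exact/eqP);
    exact/eqP.
by split; apply/forallP => x; rewrite ?(h1, h2, h3, h4, h5) ?eqxx.
Qed.

Fact gal_group_set : group_set gal.
Proof.
apply/group_setP; split=> [|s t /galP[s1 s2 s3 s4 s5] /galP[t1 t2 t3 t4 t5]].
  by apply/galP; split=> x; rewrite !perm1.
by apply/galP; split=> x;
  rewrite !permM ?(t1, t2, t3, t4, t5) ?(s1, s2, s3, s4, s5).
Qed.
Canonical gal_group := Group gal_group_set.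

Definition galois : Prop :=
  [/\ connected_graph Y, cover f
    & forall w w', vmap f w = vmap f w' -> exists2 s, s \in gal & s.1 w = w'].

End Gal.

(* [t] is the restriction to [Y] of the automorphism [s] of [Z]. *)
Definition restricts_to (Z Y : graph) (f : ghom Z Y)
    (s : {perm vert Z} * {perm edge Z}) (t : {perm vert Y} * {perm edge Y}) : Prop :=
  (forall v, vmap f (s.1 v) = t.1 (vmap f v)) /\
  (forall e, emap f (s.2 e) = t.2 (emap f e)).

Section Tower.
Variables (X_ : nat -> graph) (f_ : forall m, ghom (X_ m.+1) (X_ m)).

Fixpoint tower_proj m : ghom (X_ m) (X_ 0) :=
  if m is m'.+1 then ghom_comp (tower_proj m') (f_ m') else ghom_id (X_ 0).

Definition Zl_tower (l : nat) : Prop :=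
  [/\ forall m, connected_graph (X_ m),
      forall m, cover (f_ m)
    & forall m, (0 < m)%N -> galois (tower_proj m) /\
        (gal (tower_proj m) \isog Zp (l ^ m))].

Definition tower_gal m : {group {perm vert (X_ m)} * {perm edge (X_ m)}} :=
  gal_group (tower_proj m).

(* The inverse limit of the groups [tower_gal m], as compatible families. *)
Record tower_gal_lim := TowerGalLim {
  lim_proj : forall m, [subg tower_gal m];
  lim_projP : forall m,
    restricts_to (f_ m) (sgval (lim_proj m.+1)) (sgval (lim_proj m)) }.

End Tower.

(* [mu] and [lam] are the Iwasawa invariants of a tower with levels [X_ m];
   they are unique by [iwasawa_invariants_unique]. *)
Definition iwasawa_invariants (l : nat) (X_ : nat -> graph) (mu lam : nat) : Prop :=
  exists (nu : int) (n0 : nat), forall n, (n0 <= n)%N ->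
    (logn l (num_spanning_trees (X_ n)) : int)
      = ((mu * l ^ n + lam * n)%N%:Z + nu)%R.

Lemma iwasawa_invariants_unique l X_ mu lam mu' lam' : prime l ->
  iwasawa_invariants l X_ mu lam -> iwasawa_invariants l X_ mu' lam' ->
  mu = mu' /\ lam = lam'.
Proof.
move=> /prime_gt1 l1 [nu [n0 h]] [nu' [n0' h']].
pose n := maxn n0 n0'.
have E k : (((mu * l ^ (n + k) + lam * (n + k))%N%:Z + nu)%R
          = ((mu' * l ^ (n + k) + lam' * (n + k))%N%:Z + nu')%R).
  by rewrite -h -?h' //; rewrite /n; lia.
have E0 := E 0%N; have E1 := E 1%N; have E2 := E 2%N.
have p0 : (0 < l ^ n)%N by rewrite expn_gt0; lia.
rewrite !expnD expn1 (expnS l 1) expn1 expn0 in E0 E1 E2.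
move: (l ^ n)%N p0 E0 E1 E2 => q q0 E0 E1 E2.
have mueq : mu = mu'.
  have D : ((mu%:Z - mu'%:Z) * (q%:Z * ((l%:Z - 1) * (l%:Z - 1))) = 0)%R by nia.
  move/eqP: D; rewrite GRing.mulf_eq0 => /orP[|]; first by lia.
  by rewrite !GRing.mulf_eq0 => /orP[|/orP[|]]; lia.
by subst mu'; split=> //; nia.
Qed.

Record orientation (X : graph) := Orientation {
  orient : {set edge X};
  orient_disj : orient :&: (@einv X @: orient) = finset.set0;
  orient_cover : orient :|: (@einv X @: orient) = [set: edge X]%SET }.

Lemma orient_inv (X : graph) (S : orientation X) e :
  (einv e \in orient S) = (e \notin orient S).
Proof.
have im x : (x \in @einv X @: orient S) = (einv x \in orient S).
  by rewrite -{1}(einvK x) mem_imset //; exact: can_inj (@einvK X).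
have := orient_disj S; have := orient_cover S.
move=> /finset.setP/(_ e) + /finset.setP/(_ e).
by rewrite !inE im; do 2!case: (_ \in _).
Qed.

(* The extension to all edges of a voltage assignment on [S]; the values of
   [a] outside [S] are irrelevant. *)
Definition voltage (X : graph) (S : orientation X) (H : groupType)
    (a : edge X -> H) (e : edge X) : H :=
  if e \in orient S then a e else (a (einv e))^-1.

Lemma voltage_inv (X : graph) (S : orientation X) (H : groupType)
    (a : edge X -> H) e : voltage S a (einv e) = (voltage S a e)^-1.
Proof.
rewrite /voltage orient_inv einvK.
by case: (e \in orient S); rewrite ?invgK.
Qed.

Section Derived.
Variables (X : graph) (S : orientation X) (H : finGroupType) (a : edge X -> H).

Let dorg (x : edge X * H) := (org x.1, x.2).
Let dtgt (x : edge X * H) := (tgt x.1, x.2 * voltage S a x.1).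
Let dinv (x : edge X * H) := (einv x.1, x.2 * voltage S a x.1).

Fact derived_inv_neq x : dinv x != x.
Proof. by case: x => e h; apply/eqP => -[/eqP]; rewrite (negPf (einv_neq e)). Qed.
Fact derived_invK : involutive dinv.
Proof. by case=> e h; rewrite /dinv /= voltage_inv einvK mulgK. Qed.
Fact derived_org_inv x : dorg (dinv x) = dtgt x.
Proof. by rewrite /dorg /dtgt /= org_inv. Qed.
Fact derived_tgt_inv x : dtgt (dinv x) = dorg x.
Proof. by rewrite /dorg /dtgt /= tgt_inv voltage_inv mulgK. Qed.

Definition derived : graph :=
  @Graph (vert X * H)%type (edge X * H)%type dorg dtgt dinv
    derived_inv_neq derived_invK derived_org_inv derived_tgt_inv.

Definition derived_proj : ghom derived X :=
  @GHom derived X (fun x => x.1) (fun x => x.1)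
    (fun=> erefl) (fun=> erefl) (fun=> erefl).

End Derived.

(* The covers [X_ m] of [X_ 0] are the derived graphs of the assignments
   [b_/m], by isomorphisms over [X_ 0] which carry the maps induced by
   the restriction homomorphisms to the maps [f_ m] of the tower. *)
Definition tower_of_voltage (X_ : nat -> graph)
    (f_ : forall m, ghom (X_ m.+1) (X_ m)) (S : orientation (X_ 0))
    (b : edge (X_ 0) -> tower_gal_lim f_) : Prop :=
  exists phi : forall m,
      ghom (derived S (fun s => lim_proj (b s) m)) (X_ m),
    [/\ forall m, giso (phi m),
        forall m, (vmap (tower_proj f_ m) \o vmap (phi m) =1 fst) /\
                  (emap (tower_proj f_ m) \o emap (phi m) =1 fst)
      & forall m (s : [subg tower_gal f_ m.+1]) (t : [subg tower_gal f_ m]),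
          restricts_to (f_ m) (sgval s) (sgval t) ->
          (forall v, vmap (f_ m) (vmap (phi m.+1) (v, s)) = vmap (phi m) (v, t)) /\
          (forall e, emap (f_ m) (emap (phi m.+1) (e, s)) = emap (phi m) (e, t))].

HB.mixin Record isTopologicalGroup G of monoid.Group G & Topological G := {
  mulg_continuous : continuous (fun x : G * G => x.1 * x.2);
  invg_continuous : continuous (fun x : G => x^-1) }.

#[short(type="topGroupType")]
HB.structure Definition TopologicalGroup :=
  { G of isTopologicalGroup G & monoid.Group G & Topological G }.

Local Open Scope classical_set_scope.
Local Open Scope card_scope.

Section TopGroup.
Variable G : topGroupType.
Implicit Types (H K A B N : set G) (l : nat).

Definition subgroup H : Prop :=
  [/\ H 1, forall x y, H x -> H y -> H (x * y) & forall x, H x -> H x^-1].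

Definition normal_subgroup N : Prop :=
  subgroup N /\ forall x y, N x -> N (x ^ y).

Definition closed_gen A : set G := closure (smallest subgroup A).

Definition topologically_generates A : Prop := closed_gen A = setT.

Definition finitely_generated : Prop :=
  exists2 A : set G, finite_set A & topologically_generates A.

Definition setmulg A B : set G := [set x * y | x in A & y in B].

(* The left cosets of [H] meeting [K]: [index K H n] is [[K : H] = n]. *)
Definition cosets K H : set (set G) := [set [set x * h | h in H] | x in K].

Definition index K H (n : nat) : Prop := cosets K H #= `I_n.

Definition powsub l H : set G := closed_gen [set x ^+ l | x in H].

Definition commsub H K : set G := closed_gen [set commg x y | x in H & y in K].

(* The lower central [l]-series. *)
Fixpoint lcs l n : set G :=
  if n is n'.+1 then
    closed_gen (setmulg (powsub l (lcs l n')) (commsub (lcs l n') setT))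
  else setT.

Definition profinite : Prop :=
  [/\ hausdorff_space G, compact [set: G]
    & forall U, nbhs (1 : G) U -> exists2 H, subgroup H & open H /\ H `<=` U].

Definition pro l : Prop :=
  profinite /\
  forall N, normal_subgroup N -> open N -> exists k, index setT N (l ^ k).

Definition uniform l : Prop :=
  [/\ finitely_generated,
      commsub setT setT `<=` powsub (if l == 2 then 4 else l) setT
    & forall n, (1 <= n)%N ->
        cosets (lcs l n) (lcs l n.+1) #= cosets (lcs l 0) (lcs l 1)].

Definition uniform_dim l d : Prop :=
  [/\ uniform l, (1 <= d)%N & index (lcs l 0) (lcs l 1) (l ^ d)].

(* [pi : G -> Q] presents [Q] as the quotient group [G / N]. *)
Definition is_quotient N (Q : groupType) (pi : G -> Q) : Prop :=
  [/\ {morph pi : x y / x * y}, forall q, exists x, pi x = q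
    & forall x, pi x = 1 <-> N x].

End TopGroup.

Arguments lcs G l n : clear implicits.

(* Main.v *)
(* Expanding det(t + Laplacian) of a graph row by row gives, in degree one, the
   number of vertices times the number kappa of spanning trees.  Applied to
   Y_(n,m) and Y_(n,m+1), together with Fourier transform over the cyclic group
   of the tower, this gives l * kappa_(n,m+1) = kappa_(n,m) * D_n, where D_n is
   the product of the values f_n(z) over the z of exact order l^(m+1), and f_n is
   the determinant of the Laplacian of Y_n with coefficients in Z[Z/l^(m+1)].
   If f_n = (1 - x)^r u modulo l, with u(1) <> 0 and r less than the number of
   such z, then the l-adic valuation of D_n is r, because the product of the
   1 - z is l.  Modulo l the determinant of a circulant over an l-group H is the
   |H|-th power of the determinant of its augmentation, so f_n = f_0^(l^(dn));
   hence r is multiplied by l^(dn), and r = lambda + 1 for n = 0. *)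

Require Import Defs.
From mathcomp Require Import all_boot all_order all_algebra all_fingroup all_solvable.
From mathcomp Require Import all_field.
From mathcomp Require Import all_classical topology.
From mathcomp Require Import zify ring.

Set Implicit Arguments.
Unset Strict Implicit.
Unset Printing Implicit Defensive.

Import Order.TTheory GRing.Theory Num.Theory.
Local Open Scope group_scope.
Local Open Scope ring_scope.

(** * Determinants indexed by a finite type *)

(** The multiplicity [r] is never computed: it is read off from the growth assumed for [n = 0]. As
    [mu_0] vanishes, passing from [m] to [m + 1] raises the valuation of kappa by [lambda]; the
    factor [l] in the recursion, which is the ratio of the numbers of vertices, adds 1. This is the
    origin of [lambda + 1] and of the final [- 1]. The bounded growth also excludes [f_0 = 0] modulo
    [l], as soon as more than [r] roots [z] have exact order [l^(m+1)]. Each [m] is treated alone.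
    The polynomial [f_n] depends on exponents chosen at that [m], but the same exponents serve all
    [n] and both levels [m] and [m + 1]. Valuations are handled through divisibility between
    algebraic integers in [algC]. Determinants are Leibniz sums over the permutations of a finite
    type: the vertices of a cover are pairs, and the [l]-group acts on these permutations. *)

Definition fdet (R : comNzRingType) (T : finType) (F : T -> T -> R) : R :=
  \sum_(s : {perm T}) (-1) ^+ s * \prod_x F x (s x).

Section PermTransport.
Variables (T U : finType) (f : T -> U) (g : U -> T).
Hypotheses (fK : cancel f g) (gK : cancel g f).

Fact transport_perm_inj (s : {perm T}) : injective (f \o s \o g).
Proof.
by move=> x y /= /(can_inj fK) /perm_inj /(can_inj gK).
Qed.

Definition transport_perm (s : {perm T}) : {perm U} := perm (@transport_perm_inj s).

Lemma transport_permE s x : transport_perm s (f x) = f (s x).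
Proof. by rewrite permE /= fK. Qed.

(** Transport along a bijection takes a product of transpositions to a product of as many
    transpositions. *)
Lemma odd_transport_perm s : odd_perm (transport_perm s) = odd_perm s.
Proof.
have [ts -> _] := prod_tpermP s.
elim: ts => [|[x y] ts IH].
  rewrite big_nil odd_perm1 (_ : transport_perm 1 = 1%g) ?odd_perm1 //.
  by apply/permP=> u; rewrite -(gK u) transport_permE !perm1.
rewrite big_cons odd_permM -IH odd_tperm /=.
rewrite (_ : transport_perm _ = tperm (f x) (f y) *
   transport_perm (\prod_(t <- ts) tperm t.1 t.2))%g.
  by rewrite odd_permM odd_tperm (inj_eq (can_inj fK)).
apply/permP=> u; rewrite -(gK u) permM transport_permE permM.
by rewrite -(inj_tperm _ _ _ (can_inj fK)) transport_permE.
Qed.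

End PermTransport.

Section Fdet.
Variable R : comNzRingType.

Lemma fdet_reindex (T U : finType) (f : T -> U) (F : U -> U -> R) :
  bijective f -> fdet F = fdet (fun x y => F (f x) (f y)).
Proof.
case=> g fK gK; rewrite /fdet (reindex (transport_perm fK gK)) /=; last first.
  exists (transport_perm gK fK) => s _; apply/permP=> x;
    by do !rewrite !(permE, fK, gK) /=.
apply: eq_bigr => s _; rewrite odd_transport_perm (reindex f) /=.
  by congr (_ * _); apply: eq_bigr => x _; rewrite transport_permE.
by exists g => x _.
Qed.

Lemma eq_fdet (T : finType) (F G : T -> T -> R) : F =2 G -> fdet F = fdet G.
Proof.
by move=> E; apply: eq_bigr => s _; congr (_ * _); apply: eq_bigr => x _; rewrite E.
Qed.

Lemma fdet_ord n (F : 'I_n -> 'I_n -> R) : fdet F = \det (\matrix_(i, j) F i j).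
Proof.
by apply: eq_bigr => s _; congr (_ * _); apply: eq_bigr => x _; rewrite mxE.
Qed.

Lemma fdetE (T : finType) (F : T -> T -> R) :
  fdet F = \det (\matrix_(i < #|T|, j < #|T|) F (enum_val i) (enum_val j)).
Proof. by rewrite (fdet_reindex F (@enum_val_bij T)) fdet_ord. Qed.

Lemma fdetM (T : finType) (F G : T -> T -> R) :
  fdet (fun x y => \sum_z F x z * G z y) = fdet F * fdet G.
Proof.
rewrite !fdetE -det_mulmx; congr (\det _); apply/matrixP=> i j; rewrite !mxE.
rewrite (reindex (@enum_val T predT)) /=; last exact: (onW_bij _ (@enum_val_bij T)).
by apply: eq_bigr => k _; rewrite !mxE.
Qed.

Lemma fdet_sum_diag (T U : finType) (F : T -> T -> R) (G : U -> U -> R) :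
  fdet (fun x y : T + U => match x, y with
    | inl a, inl b => F a b | inr a, inr b => G a b | _, _ => 0 end)
  = fdet F * fdet G.
Proof.
rewrite [fdet F]fdetE [fdet G]fdetE.
rewrite -(@det_lblock _ _ _ (\matrix_(i, j) F (enum_val i) (enum_val j)) 0).
pose f (k : 'I_(#|T| + #|U|)) : T + U :=
  match fintype.split k with inl i => inl (enum_val i) | inr i => inr (enum_val i) end.
have fB : bijective f.
  pose g (x : T + U) : 'I_(#|T| + #|U|) :=
    match x with inl a => unsplit (inl (enum_rank a))
      | inr a => unsplit (inr (enum_rank a)) end.
  exists g => [k|[a|a]]; rewrite /f /g ?unsplitK ?enum_rankK //.
  by rewrite -[RHS]splitK; case: (fintype.split k) => i; rewrite enum_valK.
rewrite (fdet_reindex _ fB) fdet_ord; congr (\det _).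
apply/matrixP=> i j; rewrite !mxE /f.
by case: fintype.split => i'; rewrite mxE; case: fintype.split => j'; rewrite !mxE.
Qed.

Lemma fdet_card0 (T : finType) (F : T -> T -> R) : #|T| = 0%N -> fdet F = 1.
Proof. by move=> T0; rewrite fdetE; move: (\matrix_(_, _) _); rewrite T0 => A; exact: det_mx00. Qed.

Lemma fdet_prod_diag (T J : finType) (A : J -> T -> T -> R) :
  fdet (fun x y : T * J => if x.2 == y.2 then A x.2 x.1 y.1 else 0)
  = \prod_j fdet (A j).
Proof.
(* Over an ordinal the blocks can be split off one at a time. *)
suff H n (B : 'I_n -> T -> T -> R) :
    fdet (fun x y : T * 'I_n => if x.2 == y.2 then B x.2 x.1 y.1 else 0)
    = \prod_j fdet (B j).
  have bJ := @enum_val_bij J.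
  rewrite (reindex (@enum_val J predT)) /=; last exact: (onW_bij _ bJ).
  rewrite -H (@fdet_reindex _ _ (fun x : T * 'I_#|J| => (x.1, enum_val x.2))).
    by apply: eq_fdet => x y /=; rewrite (inj_eq (bij_inj bJ)).
  by exists (fun x => (x.1, enum_rank x.2)) => -[a b] /=; rewrite ?enum_valK ?enum_rankK.
elim: n B => [|n IH] B.
  by rewrite big_ord0 fdet_card0 // card_prod card_ord muln0.
rewrite big_ord_recl -(IH (fun j => B (lift ord0 j))) -fdet_sum_diag.
pose f (x : T + T * 'I_n) : T * 'I_n.+1 :=
  match x with inl a => (a, ord0) | inr p => (p.1, lift ord0 p.2) end.
have fB : bijective f.
  pose g (x : T * 'I_n.+1) : T + T * 'I_n :=
    match unlift ord0 x.2 with Some j => inr (x.1, j) | None => inl x.1 end.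
  exists g => [[a|[a j]]|[a j]]; rewrite /f /g /= ?unlift_none ?liftK //.
  by case: unliftP => [j' ->|->].
rewrite (fdet_reindex _ fB); apply: eq_fdet => [[a|[a j]]] [b|[b k]] //=.
Qed.

Lemma fdet_scalar (T : finType) (c : R) :
  fdet (fun x y : T => (x == y)%:R * c) = c ^+ #|T|.
Proof.
rewrite fdetE -det_scalar; congr (\det _); apply/matrixP=> i j.
by rewrite !mxE (inj_eq enum_val_inj); case: eqP; rewrite ?mul1r ?mul0r.
Qed.

Lemma fdet_map (R' : comNzRingType) (phi : {rmorphism R -> R'}) (T : finType)
    (F : T -> T -> R) : fdet (fun x y => phi (F x y)) = phi (fdet F).
Proof.
rewrite rmorph_sum; apply: eq_bigr => s _; rewrite rmorphM rmorph_sign.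
by rewrite rmorph_prod.
Qed.

Lemma fdet_perm (T : finType) (s : {perm T}) :
  fdet (fun x y => (y == s x)%:R : R) = (-1) ^+ s.
Proof.
rewrite /fdet (bigD1 s) //= [X in _ + X]big1 ?addr0; last first.
  move=> u us; have [x xE] : exists x, u x != s x.
    apply/existsP; rewrite -negb_forall; apply: contra us => /forallP h.
    by apply/eqP/permP=> x; apply/eqP.
  by rewrite (bigD1 x) //= (negPf xE) mul0r mulr0.
by rewrite big1 ?mulr1 // => x _; rewrite eqxx.
Qed.

(** The permutation matrix of [u] is block diagonal, with [#|J|] copies of the matrix of [s]. *)
Lemma odd_perm_prod_lift (T J : finType) (s : {perm T}) (u : {perm T * J}) :
  (forall x, u x = (s x.1, x.2)) -> (-1) ^+ u = ((-1) ^+ s) ^+ #|J| :> R.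
Proof.
move=> uE; rewrite -!fdet_perm -prodr_const -(@fdet_prod_diag T J (fun=> _)).
apply: eq_fdet => -[a b] [c d] /=; rewrite uE xpair_eqE /= andbC eq_sym.
by case: eqP.
Qed.

End Fdet.

Lemma fdet_kernel (R : idomainType) (T : finType) (F : T -> T -> R) (v : T -> R) x0 :
  v x0 != 0 -> (forall x, \sum_y F x y * v y = 0) -> fdet F = 0.
Proof.
move=> v0 Fv; rewrite fdetE -det_tr; apply/eqP/det0P.
exists (\row_i v (enum_val i)).
  apply/eqP=> /rowP/(_ (enum_rank x0)); rewrite !mxE enum_rankK => E.
  by rewrite E eqxx in v0.
apply/rowP=> i; rewrite !mxE -[RHS](Fv (enum_val i)).
rewrite [RHS](reindex (@enum_val T predT)) /=; last exact: (onW_bij _ (@enum_val_bij T)).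
by apply: eq_bigr => k _; rewrite !mxE mulrC.
Qed.

(** * Circulants over an l-group in characteristic l *)

(** An orbit outside the fixed points has size [l ^ k] with [k > 0], and [f] is constant on it, so
    its contribution is a multiple of [l]. *)
Lemma pgroup_sum_fix (R : nzRingType) (l : nat) (aT : finGroupType) (rT : finType)
    (to : {action aT &-> rT}) (G : {group aT}) (f : rT -> R) :
    l \in [pchar R] -> (l.-group G)%g ->
    (forall x a, a \in G -> f (to x a) = f x) ->
  \sum_x f x = \sum_(x in ('Fix_to(G))%g) f x.
Proof.
move=> chl lG fG; rewrite (bigID (fun x => x \in ('Fix_to(G))%g)) /=.
rewrite [X in _ + X](partition_big (orbit to G) predT) //= [X in _ + X]big1 ?addr0 //.
move=> O _; have [x0 /andP[x0F /eqP <-{O}] | none] :=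
    pickP (fun x => (x \notin 'Fix_to(G)) && (orbit to G x == O)); last first.
  by rewrite big_pred0.
have sumE : \sum_(x | (x \notin 'Fix_to(G)) && (orbit to G x == orbit to G x0)) f x
    = \sum_(x in orbit to G x0) f x0.
  apply: eq_big => [x|x /andP[_ /eqP/orbit_eqP/orbitP[a aG <-]]]; last by rewrite fG.
  apply/andP/idP => [[_ /eqP/orbit_eqP]|xO]; first by rewrite orbit_sym.
  have /orbit_eqP E : x \in orbit to G x0 by [].
  split; last by apply/eqP; apply/esym/orbit_eqP; rewrite orbit_sym.
  apply: contra x0F => /orbit1P xF; have := xO; rewrite orbit_sym xF => /set1P ->.
  by apply/orbit1P.
rewrite sumE sumr_const card_orbit.
have /p_natP[k kE] : (l.-nat #|G : 'C_G[x0 | to]|)%g by apply: pnat_dvd lG; exact: dvdn_indexg.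
rewrite kE; case: k kE => [|k] kE; last first.
  by rewrite expnS mulrnA (mulrn_pchar chl) mul0rn.
case/negP: x0F; apply/orbit1P; apply/eqP; rewrite eq_sym eqEcard.
by rewrite finset.sub1set orbit_refl card_orbit kE expn0 cards1.
Qed.

Lemma exprsum_pchar (R : comNzRingType) (l k : nat) (I : finType) (F : I -> R) :
  l \in [pchar R] -> (\sum_i F i) ^+ (l ^ k) = \sum_i F i ^+ (l ^ k).
Proof.
move=> chl; have nat_lk : [pchar R].-nat (l ^ k)%N.
  by rewrite pnatX pnatE ?(pcharf_prime chl) ?chl.
apply: (big_morph (fun x => x ^+ (l ^ k))) => [x y|]; first exact: exprDn_pchar.
by rewrite expr0n gtn_eqF // expn_gt0 prime_gt0 // (pcharf_prime chl).
Qed.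

Section Circulant.
Variables (R : comNzRingType) (l k : nat) (T : finType) (H : finGroupType).
Hypotheses (chl : l \in [pchar R]) (cardH : #|H| = (l ^ k)%N).
Variable a : T -> T -> H -> R.

(** The inverse makes [translate] a homomorphism, since permutations multiply from left to right. *)
Let translate_inj (h : H) : injective (fun x : T * H => (x.1, h^-1 * x.2)%g).
Proof. by move=> [x g] [y g'] /= [-> /mulgI ->]. Qed.
Let translate h : {perm T * H} := perm (@translate_inj h).

Let translateM : {morph translate : h h' / (h * h')%g}.
Proof. by move=> h h'; apply/permP=> x; rewrite permM !permE /= invMg mulgA. Qed.

Let conj_act (s : {perm T * H}) (h : H) : {perm T * H} := (s ^ translate h)%g.
Let conj_act_is_action : is_action [set: H]%SET conj_act.
Proof.
split=> [h s t /conjg_inj //|s h h' _ _]; by rewrite /conj_act translateM conjgM.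
Qed.
Let cact : {action H &-> {perm T * H}} := Action conj_act_is_action.

(** The pairs [p] form the wreath product of [H] with the permutations of [T]; the maps [eqv p] turn
    out to be exactly the permutations commuting with all left translations. *)
Let eqv_inj (p : {perm T} * {ffun T -> H}) :
  injective (fun x : T * H => (p.1 x.1, x.2 * p.2 x.1)%g).
Proof. by move=> [x g] [y g'] /= [/perm_inj -> /mulIg ->]. Qed.
Let eqv p : {perm T * H} := perm (@eqv_inj p).

Let eqv_injective : injective eqv.
Proof.
move=> [s c] [s' c'] /permP E.
have E1 x : s x = s' x /\ c x = c' x.
  by have := E (x, 1%g); rewrite !permE /= !mul1g => -[-> ->].
by congr (_, _); [apply/permP=> x | apply/ffunP=> x]; case: (E1 x).
Qed.

Let fix_eqv : ('Fix_cact([set: H]%SET))%g = eqv @: [set: {perm T} * {ffun T -> H}]%SET.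
Proof.
apply/setP=> s; apply/afixP/imsetP => [sF | [p _ ->{s}] h _]; last first.
  apply/permP=> x; rewrite /= /conj_act -[x](permKV (translate h)) permJ.
  by rewrite !permE /= mulgA.
have sE x g : s (x, g) = ((s (x, 1)).1, g * (s (x, 1)).2)%g.
  have /= := sF g^-1%g (finset.in_setT _); rewrite /conj_act => E.
  have := permJ s (translate g^-1) (x, 1%g); rewrite E !permE /= !invgK mulg1 => ->.
  by [].
have pi_inj : injective (fun x => (s (x, 1%g)).1).
  move=> x y /= E; have : s (x, 1%g) = s (y, (s (x, 1%g)).2 * (s (y, 1%g)).2^-1)%g.
    by rewrite [RHS]sE -E mulgKV; case: (s _).
  by move/perm_inj => [].
exists (perm pi_inj, [ffun x => (s (x, 1%g)).2]) => //; apply/permP=> -[x g].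
by rewrite !permE /= ffunE sE.
Qed.

(** For [l = 2] all signs are 1 in [R]. For odd [l], [eqv p] is a fibrewise shift, whose order
    divides the odd number [#|H|] and which is therefore even, followed by the lift of [p.1] to
    [#|H|] copies of [T]. *)
Let sign_eqv p : (-1) ^+ eqv p = ((-1) ^+ p.1) ^+ #|H| :> R.
Proof.
have [l2|lodd] := even_prime (pcharf_prime chl).
  have -> : -1 = 1 :> R by rewrite oppr_pchar2 // -l2.
  by rewrite !expr1n.
have oddH : odd #|H| by rewrite cardH oddX lodd orbT.
pose sh := eqv (1%g, p.2).
have shX n x : (sh ^+ n)%g x = (x.1, x.2 * p.2 x.1 ^+ n)%g.
  elim: n => [|n IH]; first by rewrite perm1 mulg1; case: x.
  by rewrite expgSr permM IH permE /= perm1 expgSr mulgA.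
have sh1 : odd_perm sh = false.
  have : odd_perm (sh ^+ #|H|)%g = false.
    rewrite (_ : (sh ^+ _)%g = 1%g) ?odd_perm1 //; apply/permP=> x.
    rewrite shX perm1 (_ : p.2 x.1 ^+ #|H| = 1)%g ?mulg1; first by case: x.
    by rewrite -cardsT expg_cardG ?inE.
  have odX n : odd_perm (sh ^+ n)%g = odd n && odd_perm sh.
    elim: n => [|n IH]; first by rewrite odd_perm1.
    by rewrite expgS odd_permM IH /=; case: odd; case: odd_perm.
  by rewrite odX oddH.
pose li := eqv (p.1, [ffun=> 1%g]).
have -> : eqv p = (sh * li)%g.
  by apply/permP=> x; rewrite permM !permE /= ffunE mulg1 ?perm1.
rewrite odd_permM sh1 addFb; apply: odd_perm_prod_lift => x.
by rewrite permE /= ffunE mulg1.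
Qed.

(* Modulo [l], only the permutations of [T * H] commuting with the translations
   by [H] contribute to the Leibniz formula. *)
Lemma fdet_circulant_pchar :
  fdet (fun x y : T * H => a x.1 y.1 (x.2^-1 * y.2)%g)
  = (fdet (fun x y => \sum_h a x y h)) ^+ #|H|.
Proof.
have inv s h : h \in [set: H]%SET ->
    (-1) ^+ cact s h * \prod_x a x.1 (cact s h x).1 (x.2^-1 * (cact s h x).2)%g
    = (-1) ^+ s * \prod_x a x.1 (s x).1 (x.2^-1 * (s x).2)%g.
  move=> _; rewrite /= /conj_act odd_permJ; congr (_ * _).
  rewrite (reindex_inj (@perm_inj _ (translate h))); apply: eq_bigr => x _.
  by rewrite permJ !permE /= invMg invgK mulgA mulgK.
rewrite {1}/fdet (pgroup_sum_fix (to := cact) (G := [set: H]%G) chl _ inv); last first.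
  by rewrite /pgroup cardsT cardH pnatX pnat_id ?(pcharf_prime chl).
rewrite fix_eqv big_imset /=; last by move=> p q _ _; exact: eqv_injective.
have prodE p : \prod_x a x.1 (eqv p x).1 (x.2^-1 * (eqv p x).2)%g
    = (\prod_x a x (p.1 x) (p.2 x)) ^+ #|H|.
  transitivity (\prod_x \prod_(g : H) a x (p.1 x) (p.2 x)).
    by rewrite pair_bigA; apply: eq_bigr => -[x g] _; rewrite permE /= mulKg.
  by rewrite -prodrXl; apply: eq_bigr => x _; rewrite -prodr_const.
under eq_bigr => p _ do rewrite prodE sign_eqv -exprMn.
rewrite big_mkcond /=; under eq_bigr => p _ do rewrite inE.
(* Frobenius takes the power out of the sum over pairs; what remains of the sum over [c] is the
   expanded product of the row sums over [H]. *)
rewrite cardH -exprsum_pchar //; congr (_ ^+ _).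
rewrite -(pair_bigA _ (fun (s : {perm T}) (c : {ffun T -> H}) =>
  (-1) ^+ s * \prod_x a x (s x) (c x))) /=.
apply: eq_bigr => s _; rewrite -big_distrr /=; congr (_ * _).
by rewrite bigA_distr_bigA.
Qed.

End Circulant.

(** * The matrix-tree theorem *)

Section Forest.
Variable Y : graph.
Local Notation V := (vert Y).
Local Notation E := (edge Y).
Implicit Types (phi psi : {ffun V -> option E}) (T : {set E}) (r : V).

(** Summing over outgoing edges makes loops cancel and writes each row as a sum of rows of single
    edges. *)
Definition laplacian (R : nzRingType) (v w : V) : R :=
  \sum_(e in star v) ((v == w)%:R - (tgt e == w)%:R).

Definition laplacian_charpoly : {poly int} :=
  fdet (fun v w => (v == w)%:R * 'X + laplacian _ v w).

(** Choices of a term in each row: [None] picks the term in ['X], [Some e] the term of the outgoing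
    edge [e]. *)
Definition out_choice (v : V) : pred (option E) :=
  [pred c | if c is Some e then e \in star v else true].

(** The absence of directed cycles, witnessed by a height that decreases along the chosen edges and
    supports inductions. *)
Definition acyclic_choice phi : Prop :=
  exists d : V -> nat, forall v e, phi v = Some e -> (d (tgt e) < d v)%N.

Definition rooted_choice r phi : bool :=
  [&& phi \in family out_choice, `[< acyclic_choice phi >]
    & [forall v, (phi v == None) == (v == r)]].

(** Follow the chosen edges. If every vertex reaches one without choice, the number of steps is a
    height; otherwise [B] is the set of vertices that never do, and its indicator will be a kernel
    vector. *)
Lemma acyclic_choiceP phi : acyclic_choice phi \/
  exists2 B : {set V}, B != finset.set0 &
    forall v, if phi v is Some e then (v \in B) = (tgt e \in B) else v \notin B.
Proof.
pose nxt v := if phi v is Some e then tgt e else v.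
pose ends v k := phi (iter k nxt v) == None.
have [allv|] := pselect (forall v, exists k, ends v k).
  left; exists (fun v => ex_minn (allv v)) => v e phiv.
  case: (ex_minnP (allv v)) => -[|k]; rewrite /ends /= ?phiv // => + _.
  rewrite -iterS iterSr {2}/nxt phiv => endk.
  by case: ex_minnP => m _ /(_ _ endk); rewrite ltnS.
move=> /existsNP[v0 nv0]; right.
exists [set v | `[< ~ exists k, ends v k >]]%SET.
  by apply/set0Pn; exists v0; rewrite inE; apply/asboolP.
move=> v; case phiv: (phi v) => [e|]; rewrite !inE; last first.
  by apply/asboolP; apply; exists 0%N; rewrite /ends /= phiv.
apply: asbool_equiv_eq; split; apply: contra_not => -[k].
  by exists k.+1; rewrite /ends iterSr {2}/nxt phiv.
case: k => [|k]; first by rewrite /ends /= phiv.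
by rewrite /ends iterSr {2}/nxt phiv; exists k.
Qed.

Let rho (c : option E) (v w : V) : {poly int} :=
  if c is Some e then (v == w)%:R - (tgt e == w)%:R else (v == w)%:R * 'X.

(** Ordered by height the matrix is triangular: a vertex of least height moved by [s] would be sent
    along its chosen edge to a lower vertex, which [s] moves as well. *)
Let fdet_acyclic phi : acyclic_choice phi ->
  fdet (fun v w => rho (phi v) v w) = 'X^#|[pred v | phi v == None]|.
Proof.
case=> d dP; rewrite /fdet (bigD1 1%g) //= [X in _ + X]big1 ?addr0.
  rewrite odd_perm1 mul1r -prodr_const [RHS]big_mkcond; apply: eq_bigr => v _.
  rewrite perm1 /rho inE; case phiv: (phi v) => [e|] /=; rewrite eqxx ?mul1r //.
  by case: eqP => [tv|]; [have := dP v e phiv; rewrite tv ltnn | rewrite subr0].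
move=> s s1; apply/eqP; rewrite mulf_eq0; apply/orP; right; apply/prodf_eq0.
have [v0 v0P] : exists v, s v != v.
  apply/existsP; rewrite -negb_forall; apply: contra s1 => /forallP h.
  by apply/eqP/permP=> x; rewrite perm1; apply/eqP.
have [v svv vmin] := arg_minnP (P := fun v => s v != v) d v0P.
exists v => //; rewrite /rho; case phiv: (phi v) => [e|]; last first.
  by rewrite [v == _]eq_sym (negPf svv) mul0r.
rewrite [v == _]eq_sym (negPf svv) sub0r oppr_eq0.
case: (tgt e =P s v) => [tE|]; last by rewrite eqxx.
have := dP v e phiv; rewrite tE ltnNge vmin //.
by apply: contra svv => /eqP /perm_inj ->.
Qed.

Let fdet_cyclic phi : ~ acyclic_choice phi -> fdet (fun v w => rho (phi v) v w) = 0.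
Proof.
have [//|[B /set0Pn[v0 v0B] BP] _] := acyclic_choiceP phi.
apply: (@fdet_kernel _ _ _ (fun v => (v \in B)%:R) v0) => [|v].
  by rewrite v0B oner_eq0.
have sumB a : \sum_y (a == y)%:R * (y \in B)%:R = (a \in B)%:R :> {poly int}.
  rewrite (bigD1 a) //= eqxx mul1r big1 ?addr0 // => y ya.
  by rewrite eq_sym (negPf ya) mul0r.
have := BP v; rewrite /rho; case: (phi v) => [e|] vB.
  by under eq_bigr => y _ do rewrite mulrBl; rewrite sumrB !sumB vB subrr.
under eq_bigr => y _ do rewrite mulrAC.
by rewrite -mulr_suml sumB (negPf vB) mul0r.
Qed.

Lemma laplacian_charpolyE : laplacian_charpoly =
  \sum_(phi in family out_choice)
    if `[< acyclic_choice phi >] then 'X^#|[pred v | phi v == None]| else 0.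
Proof.
have rowE v w : (v == w)%:R * 'X + laplacian _ v w =
    \sum_(c | out_choice v c) rho c v w.
  rewrite (bigD1 None) //=; congr (_ + _).
  rewrite (reindex_omap Some id) /=; last by move=> [e|] //; rewrite eqxx andbF.
  by rewrite /laplacian; apply: eq_bigl => e; rewrite /= eqxx !andbT.
transitivity (\sum_(phi in family out_choice) fdet (fun v w => rho (phi v) v w)).
  rewrite exchange_big /=; apply: eq_bigr => s _.
  rewrite -big_distrr /=; congr (_ * _).
  by under eq_bigr => v _ do rewrite rowE; rewrite bigA_distr_big_dep.
apply: eq_bigr => phi _; case: asboolP; [exact: fdet_acyclic | exact: fdet_cyclic].
Qed.

Lemma laplacian_charpoly0 : (0 < #|V|)%N -> laplacian_charpoly`_0 = 0.
Proof.
move=> V0; rewrite laplacian_charpolyE coef_sum big1 // => phi _.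
case: asboolP => [[d dP]|_]; last by rewrite coef0.
have /card_gt0P[v0 _] := V0.
have [v _ vmin] := arg_minnP (P := predT) d (isT : predT v0).
case phiv: (phi v) => [e|].
  by have := dP _ _ phiv; rewrite ltnNge vmin.
rewrite coefXn eq_sym gtn_eqF //; apply/card_gt0P; exists v.
by rewrite inE phiv.
Qed.

Lemma laplacian_charpoly1 :
  laplacian_charpoly`_1 = (\sum_r #|[pred phi | rooted_choice r phi]|)%N%:R.
Proof.
rewrite laplacian_charpolyE coef_sum natr_sum.
under [RHS]eq_bigr => r _ do rewrite -sum1_card natr_sum big_mkcond.
rewrite exchange_big big_mkcond /=; apply: eq_bigr => phi _.
under eq_bigr => r _ do rewrite inE /rooted_choice.
case: (phi \in _) => /=; last by rewrite big1.
case: asboolP => _ /=; last by rewrite coef0 big1.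
have rootP r : [forall v, (phi v == None) == (v == r)] ->
    #|[pred v | phi v == None]| = 1%N.
  by move=> /forallP rP; rewrite -(card1 r); apply: eq_card => v; rewrite !inE (eqP (rP v)).
rewrite coefXn eq_sym; case: eqP => [n1|n1]; last first.
  by rewrite big1 // => r _; case: ifP => // /rootP.
have /card_gt0P[r rN] : (0 < #|[pred v | phi v == None]|)%N by rewrite n1.
have rU : [forall v, (phi v == None) == (v == r)].
  apply/forallP=> v; apply/eqP; apply/idP/eqP => [vN|->//].
  by have /card_le1_eqP U := eq_leq n1; apply: U; rewrite ?inE.
rewrite (bigD1 r) //= rU big1 ?addr0 // => r' r'r; case: ifP => // /forallP/(_ r).
by move: rN; rewrite inE [r == r']eq_sym (negPf r'r) => ->.
Qed.

Definition choice_tree phi : {set E} :=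
  [set e | (phi (org e) == Some e) || (phi (org (einv e)) == Some (einv e))]%SET.

Lemma choice_tree_inv phi e : (einv e \in choice_tree phi) = (e \in choice_tree phi).
Proof. by rewrite !inE einvK orbC. Qed.

Lemma adj_sym T : (forall e, e \in T -> einv e \in T) -> symmetric (adj T).
Proof.
move=> Tinv; suff H v w : adj T v w -> adj T w v by move=> v w; apply/idP/idP; apply: H.
case/exists_inP=> e eT /andP[ov tw]; apply/exists_inP; exists (einv e); first exact: Tinv.
by rewrite org_inv tgt_inv ov tw.
Qed.

Lemma choice_tree_connected r phi :
  rooted_choice r phi -> spans_connected (choice_tree phi).
Proof.
case/and3P=> /familyP phiV /asboolP[d dP] /forallP rP.
have symT : connect_sym (adj (choice_tree phi)).
  by apply: sym_connect_sym; apply: adj_sym => e; rewrite choice_tree_inv.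
have toroot v : connect (adj (choice_tree phi)) v r.
  have [n] := ubnP (d v); elim: n v => // n IH v dv.
  case phiv: (phi v) => [e|]; last first.
    by have := rP v; rewrite phiv eqxx => /eqP/esym/eqP ->; exact: connect0.
  have := phiV v; rewrite inE phiv inE => /eqP oe.
  apply: (connect_trans (y := tgt e)).
    apply: connect1; apply/exists_inP; exists e; first by rewrite inE oe phiv eqxx.
    by rewrite oe !eqxx.
  by apply: IH; apply: leq_trans (dP _ _ phiv) _.
by move=> v w; apply: connect_trans (toroot v) _; rewrite symT.
Qed.

(** Take an edge [e] of the circuit whose origin has maximal height. Both [e] and the reverse of the
    preceding edge descend from that origin, hence both are its choice, and the circuit
    backtracks. *)
Lemma choice_tree_no_circuit phi p :
  acyclic_choice phi -> circuit p -> ~ {subset p <= choice_tree phi}.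
Proof.
move=> [d dP] [pn0 pcyc _] pT.
have [e0 e0p] : exists e0, e0 \in p by case: p pn0 {pcyc pT} => // e0 p; exists e0; rewrite inE eqxx.
have [e ep emax] := arg_maxnP (fun e => d (org e)) e0p.
have {}emax e' : e' \in p -> (d (org e') <= d (org e))%N by move/emax.
have /andP[/eqP tn _] := next_cycle pcyc ep.
have /andP[/eqP tp nback] := prev_cycle pcyc ep.
have phie : phi (org e) = Some e.
  have := pT e ep; rewrite inE => /orP[/eqP //|/eqP /dP].
  by rewrite org_inv tgt_inv tn ltnNge emax // mem_next.
have p'p : prev p e \in p by rewrite mem_prev.
have := pT _ p'p; rewrite inE => /orP[/eqP /dP|/eqP].
  by rewrite tp ltnNge emax.
by rewrite org_inv tp phie => -[/eqP]; rewrite (negPf nback).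
Qed.

Lemma choice_tree_spanning r phi :
  rooted_choice r phi -> spanning_tree (choice_tree phi).
Proof.
move=> rphi; split=> [e||p]; first by rewrite choice_tree_inv.
  exact: choice_tree_connected rphi.
by case/and3P: rphi => _ /asboolP ac _; exact: choice_tree_no_circuit.
Qed.

(** Induction on the height for [phi]. If [psi] used the chosen edge [e] in the opposite direction,
    so would [phi] by induction, and the height would decrease both ways along [e]. *)
Lemma choice_tree_inj r :
  {in rooted_choice r &, injective choice_tree}.
Proof.
move=> phi psi /and3P[/familyP phiV /asboolP[d dP] /forallP rP].
move=> /and3P[/familyP psiV /asboolP _ /forallP rP'] TE.
apply/ffunP=> v; have [n] := ubnP (d v); elim: n v => // n IH v dv.
case phiv: (phi v) => [e|]; last first.
  by have := rP v; have := rP' v; rewrite phiv => /eqP <- /eqP/esym/eqP.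
have := phiV v; rewrite inE phiv inE => /eqP oe.
have : e \in choice_tree psi by rewrite -TE inE oe phiv eqxx.
rewrite inE oe org_inv => /orP[/eqP -> //|/eqP psie].
have dte := dP _ _ phiv; have := IH (tgt e) (leq_trans dte dv); rewrite psie.
by move=> /dP; rewrite tgt_inv oe ltnNge ltnW.
Qed.

(* Each vertex chooses the first edge of a shortest path to [r]. *)
Lemma shortest_path_choice T r : spans_connected T ->
  exists2 phi, rooted_choice r phi & forall v e, phi v = Some e -> e \in T.
Proof.
move=> Tc; pose reach v k := [exists p : k.-tuple V, path (adj T) v p && (last v p == r)].
have reachP v : exists k, reach v k.
  have /connectP[p pp rE] := Tc v r; exists (size p); apply/existsP.
  by exists (in_tuple p); rewrite pp -rE eqxx.
pose d v := ex_minn (reachP v).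
pose phi := [ffun v => if v == r then None else
  [pick e in T | (org e == v) && (d (tgt e) < d v)%N]].
have phiE v : v != r -> exists2 e, phi v = Some e & [/\ e \in T, org e = v & (d (tgt e) < d v)%N].
  move=> vr; rewrite /phi ffunE (negPf vr); case: pickP => [e /and3P[eT /eqP oe de]|].
    by exists e.
  rewrite {2}/d; case: ex_minnP => k /existsP[[[|w p] /= /eqP sp]].
    by rewrite (negPf vr).
  case/andP=> /andP[/exists_inP[e eT /andP[/eqP oe /eqP te]] pp] lastr _ /(_ e).
  rewrite eT oe eqxx te /= => /negP[]; rewrite -sp ltnS /d.
  case: ex_minnP => m _; apply; apply/existsP; exists (in_tuple p).
  by rewrite pp.
have phir : phi r = None by rewrite ffunE eqxx.
have phiP v e : phi v = Some e -> [/\ e \in T, org e = v & (d (tgt e) < d v)%N].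
  have [->|/phiE[e' -> h [<-]] //] := eqVneq v r; by rewrite phir.
exists phi => [|v e /phiP[] //]; apply/and3P; split.
- apply/familyP=> v; rewrite inE; case phiv: (phi v) => [e|] //.
  by have [_ <- _] := phiP _ _ phiv; rewrite inE.
- by apply/asboolP; exists d => v e /phiP[].
- apply/forallP=> v; have [->|vr] := eqVneq v r; first by rewrite phir.
  by have [e -> _] := phiE v vr.
Qed.

(** A path through distinct vertices cannot backtrack. The edge [e0] entering [x] is carried along
    so that it can close the path to a circuit. *)
Lemma lift_simple_path T (e0 : E) (x : V) (p : seq V) :
  path (adj T) x p -> uniq (x :: p) -> tgt e0 = x ->
  (forall e, e \in T -> tgt e \in p -> e != einv e0) ->
  exists q, [/\ {subset q <= T}, map (@org Y) q = belast x p,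
    path (fun e e' => (tgt e == org e') && (e' != einv e)) e0 q
    & tgt (last e0 q) = last x p].
Proof.
elim: p e0 x => [|w p IH] e0 x /=; first by move=> _ _ tx _; exists [::].
case/andP=> /exists_inP[e eT /andP[/eqP oe /eqP te]] pp /andP[xwp up] tx e0P.
have [e' _ te'|q [qT oq pq tq]] := IH e w pp up te.
  apply: contra xwp => /eqP e'E; rewrite inE; apply/orP; right.
  by rewrite -oe -(tgt_inv e) -e'E.
exists (e :: q); split=> //=; first by move=> e'; rewrite inE => /predU1P[->|/qT].
  by rewrite oe oq.
by rewrite tx oe eqxx pq andbT e0P // te inE eqxx.
Qed.

(** A further edge [e] of [T] would close a simple path of the choice tree from [tgt e] to [org e]
    to a circuit inside [T]. *)
Lemma spanning_tree_minimal T r phi : spanning_tree T -> rooted_choice r phi ->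
  {subset choice_tree phi <= T} -> choice_tree phi = T.
Proof.
move=> [Tinv _ Tcirc] rphi sub; apply/setP/subset_eqP/andP; split; apply/fintype.subsetP=> //.
move=> e eT; apply: contraT => eT'; exfalso.
have /connectP[p0 pp0] := choice_tree_connected rphi (tgt e) (org e).
case/shortenP: pp0 => p pp up _ oe.
have [|q [qT oq pq tq]] := lift_simple_path pp up (erefl (tgt e)).
  move=> e' e'T _; apply: contra eT' => /eqP e'E; by rewrite -choice_tree_inv -e'E.
apply: (Tcirc (e :: q)); last by move=> e'; rewrite inE => /predU1P[->//|/qT/sub].
split=> //=.
  rewrite rcons_path pq tq -oe eqxx /=.
  (* With [q] empty, [e] is a loop and is a circuit by itself. *)
  case/lastP: q qT {oq pq tq} => [_|q e']; first by rewrite /= eq_sym einv_neq.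
  move=> /(_ e'); rewrite last_rcons mem_rcons inE eqxx => /(_ isT) e'T.
  by apply: contra eT' => /eqP ->; rewrite choice_tree_inv.
by rewrite oq oe -rcons_uniq -lastI.
Qed.

(** A spanning tree has exactly one orientation towards [r], so the count is the same for every
    root. *)
Lemma card_rooted_choice r :
  #|[pred phi | rooted_choice r phi]| = num_spanning_trees Y.
Proof.
rewrite /num_spanning_trees -(card_in_imset (@choice_tree_inj r)).
apply: eq_card => T; rewrite inE; apply/imsetP/asboolP => [[phi rphi ->]|Tt].
  exact: choice_tree_spanning rphi.
have [Tinv Tc _] := Tt; have [phi rphi phiT] := shortest_path_choice r Tc.
exists phi => //; apply/esym; apply: spanning_tree_minimal rphi _ => // e.
rewrite inE => /orP[/eqP/phiT //|/eqP/phiT/Tinv]; by rewrite einvK.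
Qed.

Lemma num_spanning_trees_gt0 : connected_graph Y -> (0 < num_spanning_trees Y)%N.
Proof.
case=> /card_gt0P[r _] Yc; rewrite -(card_rooted_choice r).
have [phi rphi _] := shortest_path_choice r Yc.
by apply/card_gt0P; exists phi.
Qed.

Lemma matrix_tree : laplacian_charpoly`_1 = (#|V| * num_spanning_trees Y)%N%:R.
Proof.
rewrite laplacian_charpoly1; congr (_%:R).
by under eq_bigr => r _ do rewrite card_rooted_choice; rewrite sum_nat_const.
Qed.

End Forest.

(** * Circulants over a cyclic group *)

(** The columns of [chi] are common eigenvectors of the blocks: [M * W = W * B] with [B] block
    diagonal. The relation with [chi'] only serves to show that [fdet W] is nonzero and can be
    cancelled. *)
Lemma fdet_block_eigen (R : idomainType) (T J : finType) (M : T * J -> T * J -> R)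
    (chi chi' : J -> J -> R) (c : R) (A : J -> T -> T -> R) :
  c != 0 -> (forall i j, \sum_k chi i k * chi' k j = (i == j)%:R * c) ->
  (forall x i y k, \sum_j M (x, i) (y, j) * chi j k = chi i k * A k x y) ->
  fdet M = \prod_k fdet (A k).
Proof.
move=> c0 chiK chiM.
pose W (chi : J -> J -> R) (x y : T * J) := (x.1 == y.1)%:R * chi x.2 y.2.
pose B (x y : T * J) := if x.2 == y.2 then A x.2 x.1 y.1 else 0.
have pairsum (y : T) (F : J -> R) (b : T * J -> R) :
    \sum_z b z * ((z.1 == y)%:R * F z.2) = \sum_j b (y, j) * F j.
  transitivity (\sum_u \sum_j b (u, j) * ((u == y)%:R * F j)).
    by rewrite pair_bigA; apply: eq_bigr => -[].
  rewrite (bigD1 y) //= [X in _ + X]big1 ?addr0 => [|u uy].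
    by apply: eq_bigr => j _; rewrite eqxx mul1r.
  by rewrite big1 // => j _; rewrite (negPf uy) mul0r mulr0.
have pairsum' (x : T) (F : J -> R) (b : T * J -> R) :
    \sum_z ((x == z.1)%:R * F z.2) * b z = \sum_j F j * b (x, j).
  rewrite (eq_bigr (fun z => b z * ((z.1 == x)%:R * F z.2))) => [|z _].
    by rewrite pairsum //; apply: eq_bigr => j _; rewrite mulrC.
  by rewrite mulrC [x == _]eq_sym.
have MW : fdet M * fdet (W chi) = fdet (W chi) * fdet B.
  rewrite -!fdetM; apply: eq_fdet => -[x i] [y k]; rewrite /W /=.
  rewrite (pairsum y (chi^~ k)) chiM (pairsum' x (chi i) (B^~ (y, k))) /B /=.
  rewrite (bigD1 k) //= eqxx big1 ?addr0 // => j jk.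
  by rewrite (negPf jk) mulr0.
have W0 : fdet (W chi) != 0.
  suff : fdet (W chi) * fdet (W chi') != 0 by rewrite mulf_eq0 negb_or => /andP[].
  rewrite -fdetM (eq_fdet (G := fun x y => (x == y)%:R * c)).
    by rewrite fdet_scalar expf_neq0.
  move=> -[x i] [y k]; rewrite /W /=.
  rewrite (pairsum' x (chi i) (fun z => (z.1 == y)%:R * chi' z.2 k)) /=.
  under eq_bigr => j _ do rewrite mulrCA.
  by rewrite -big_distrr /= chiK mulrA -natrM mulnb xpair_eqE.
by move: MW; rewrite mulrC => /(mulfI W0) ->; exact: fdet_prod_diag.
Qed.

Section Fourier.
Variables (R : idomainType) (gT : finGroupType) (g0 : gT) (N : nat) (z : R).
Hypotheses (gen : [set: gT]%SET = <[g0]>%g) (cardN : #|gT| = N).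
Hypotheses (zN : N.-primitive_root z) (N0 : N%:R != 0 :> R).

Lemma cyclic_log : exists2 lam : gT -> nat, forall g, (lam g < N)%N &
  forall g, (g0 ^+ lam g)%g = g.
Proof.
have ord0 : #[g0]%g = N by rewrite -cardN -cardsT gen.
have H g : exists k, (k < N)%N && ((g0 ^+ k)%g == g).
  have : g \in <[g0]>%g by rewrite -gen inE.
  by case/cyclePmin => k; rewrite ord0 => kN ->; exists k; rewrite kN eqxx.
by exists (fun g => xchoose (H g)) => g; have /andP[? /eqP] := xchooseP (H g).
Qed.

Lemma expg_expr_eq a b : (g0 ^+ a)%g = (g0 ^+ b)%g -> z ^+ a = z ^+ b.
Proof.
have ord0 : #[g0]%g = N by rewrite -cardN -cardsT gen.
move=> /eqP; rewrite eq_expg_mod_order ord0 => /eqP E; apply/eqP.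
by rewrite (eq_prim_root_expr zN); apply/eqP.
Qed.

Lemma sum_prim_root_expr a : \sum_(i < N) z ^+ (a * i) = (N %| a)%:R * N%:R.
Proof.
under eq_bigr => i _ do rewrite exprM.
rewrite (prim_order_dvd zN); case: (eqVneq (z ^+ a) 1) => [->|za].
  by under eq_bigr => i _ do rewrite expr1n; rewrite sumr_const card_ord mul1r.
rewrite mul0r; apply: (@mulfI _ (z ^+ a - 1)); first by rewrite subr_eq0.
by rewrite -subrX1 mulr0 -exprM mulnC exprM (prim_expr_order zN) expr1n subrr.
Qed.

Lemma fdet_circulant_fourier (T : finType) (b : T -> T -> gT -> R)
    (lam : gT -> nat) : (forall g, (g0 ^+ lam g)%g = g) ->
  fdet (fun x y : T * gT => b x.1 y.1 (x.2^-1 * y.2)%g)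
  = \prod_(i < N) fdet (fun x y => \sum_h b x y h * (z ^+ i) ^+ lam h).
Proof.
move=> lamP; have [mu muN muP] := cyclic_log.
have muE g k : z ^+ (mu g * k) = z ^+ (lam g * k).
  by rewrite !exprM (@expg_expr_eq (mu g) (lam g)) // muP lamP.
have N_gt0 : (0 < N)%N := prim_order_gt0 zN.
have mu_surj (i : 'I_N) : mu (g0 ^+ i)%g = i.
  have ord0 : #[g0]%g = N by rewrite -cardN -cardsT gen.
  have /eqP := muP (g0 ^+ i)%g; rewrite eq_expg_mod_order ord0.
  by rewrite !modn_small // => /eqP.
have muB : {on [pred i | true], bijective (fun g => Ordinal (muN g))}.
  exists (fun i : 'I_N => (g0 ^+ i)%g) => [g _|i _] /=; first exact: muP.
  exact/val_inj/mu_surj.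
rewrite [RHS](reindex (fun g => Ordinal (muN g))) //=.
(* The characters of the cyclic group, indexed by the group itself; [N - mu g] is the exponent of
   the inverse. *)
apply: (@fdet_block_eigen _ _ _ _ (fun g k => z ^+ (mu g * mu k))
  (fun k g => z ^+ ((N - mu g) * mu k)) N%:R) => // [g g'|x g y k].
  under eq_bigr => k _ do rewrite -exprD -mulnDl.
  transitivity (\sum_(i < N) z ^+ ((mu g + (N - mu g')) * i)).
    by rewrite [RHS](reindex (fun g => Ordinal (muN g))).
  rewrite sum_prim_root_expr; congr (_%:R * _).
  have -> : (g == g') = (mu g == mu g').
    by apply/eqP/eqP => [->//|E]; rewrite -(muP g) E muP.
  congr nat_of_bool; have lt1 := muN g; have lt2 := muN g'.
  apply/idP/eqP => [/dvdnP[k kE]|->]; last by rewrite subnKC // ltnW.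
  (* [mu g + (N - mu g')] lies strictly between 0 and [2 * N], so [k] is 1. *)
  case: k kE => [|[|k]] kE; [lia | lia | nia].
rewrite (reindex_inj (mulgI g)) /= big_distrr /=; apply: eq_bigr => h _.
rewrite mulKg mulrCA; congr (_ * _); rewrite -!exprM [(mu k * lam h)%N]mulnC !muE.
rewrite -exprD -mulnDl !exprM; congr (_ ^+ _); apply: expg_expr_eq.
by rewrite expgnDr !lamP.
Qed.

End Fourier.

(** * Laplacians of derived graphs and their factorisation *)

Section TwistedLaplacian.
Variables (X : graph) (Q : finGroupType) (p : edge X -> Q) (a : edge X -> nat).

(* The Laplacian of the derived graph of [Q] with coefficients in the group
   ring of a cyclic group, whose generator is specialised to [y]. *)
Definition twisted_laplacian (R : nzRingType) (y : R) (u w : vert X * Q) : R :=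
  \sum_(e in star u.1)
    ((u == w)%:R - ((tgt e == w.1) && (u.2 * p e == w.2)%g)%:R * y ^+ a e).

Lemma twisted_laplacian_map (R R' : nzRingType) (phi : {rmorphism R -> R'}) y u w :
  phi (twisted_laplacian y u w) = twisted_laplacian (phi y) u w.
Proof.
rewrite rmorph_sum; apply: eq_bigr => e _.
by rewrite rmorphB rmorphM rmorphXn !rmorph_nat.
Qed.

(** Exponents [a e] are natural numbers for both directions of an edge, so this is a polynomial. One
    integer polynomial can then be both evaluated at roots of unity and reduced modulo [l]. *)
Definition twisted_det : {poly int} := fdet (twisted_laplacian 'X).

Lemma fdet_twisted_laplacian (R : comNzRingType) (y : R) :
  fdet (twisted_laplacian y) = (map_poly intr twisted_det).[y].
Proof.
rewrite -/(horner_eval y _) -!fdet_map; apply: eq_fdet => u w.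
by rewrite !twisted_laplacian_map /= map_polyX /horner_eval hornerX.
Qed.

End TwistedLaplacian.

Section DerivedLaplacian.
Variables (X : graph) (S : orientation X) (Q gT : finGroupType).
Variables (c : edge X -> (Q * gT)%type) (p : edge X -> Q) (a : edge X -> nat) (g0 : gT).
Hypothesis gen : [set: gT]%SET = <[g0]>%g.
Hypothesis voltE : forall e, voltage S c e = (p e, g0 ^+ a e)%g.

Let lapE (R : nzRingType) v q g w q' g' :
  @laplacian (derived S c) R (v, (q, g)) (w, (q', g')) =
  \sum_(e in star v) (((v, q) == (w, q'))%:R * ((g^-1 * g')%g == 1%g)%:R
    - ((tgt e == w) && ((q * p e)%g == q'))%:R * ((g^-1 * g')%g == (g0 ^+ a e)%g)%:R).
Proof.
rewrite /laplacian (reindex_omap (fun e : edge X => (e, (q, g)) : edge (derived S c))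
  (fun E => if E.2 == (q, g) then Some E.1 else None)) /=; last first.
  by move=> [e h]; rewrite inE xpair_eqE /= => /andP[_ /eqP ->]; rewrite eqxx.
apply: eq_big => [e|e _].
  by rewrite !inE /= xpair_eqE !eqxx andbT /= andbT.
rewrite voltE !xpair_eqE /= -!natrM !mulnb.
rewrite -[(g^-1 * g')%g == 1%g](inj_eq (mulgI g)) mulg1 mulKVg.
rewrite -[(g^-1 * g')%g == _](inj_eq (mulgI g)) mulKVg [g' == g]eq_sym.
by rewrite [g' == _]eq_sym !andbA.
Qed.

Lemma laplacian_charpoly_derived (z : algC) : #|gT|.-primitive_root z ->
  map_poly intr (laplacian_charpoly (derived S c)) =
  \prod_(i < #|gT|) fdet (fun u w : vert X * Q =>
    (u == w)%:R * 'X + (twisted_laplacian p a (z ^+ i) u w)%:P).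
Proof.
move=> zN; rewrite /laplacian_charpoly -fdet_map.
pose f (x : (vert X * Q) * gT) : vert (derived S c) := (x.1.1, (x.1.2, x.2)).
have fB : bijective f.
  by exists (fun y => ((y.1, y.2.1), y.2.2)) => [[[v q] g]|[v [q g]]].
rewrite (fdet_reindex _ fB).
pose b (x y : vert X * Q) (h : gT) : {poly algC} := (x == y)%:R * (h == 1%g)%:R * 'X +
  \sum_(e in star x.1) ((x == y)%:R * (h == 1%g)%:R
    - ((tgt e == y.1) && ((x.2 * p e)%g == y.2))%:R * (h == (g0 ^+ a e)%g)%:R).
rewrite (eq_fdet (G := fun x y => b x.1 y.1 (x.2^-1 * y.2)%g)); last first.
  move=> [[v q] g] [[w q'] g']; rewrite /f /b /= rmorphD rmorphM /= map_polyX rmorph_nat.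
  rewrite !xpair_eqE; congr (_ * 'X + _).
    rewrite -natrM mulnb -[(g^-1 * g')%g == 1%g](inj_eq (mulgI g)) mulg1 mulKVg.
    by rewrite [g' == g]eq_sym andbA.
  rewrite lapE rmorph_sum; apply: eq_bigr => e _.
  by rewrite rmorphB !rmorphM !rmorph_nat.
have zN' : #|gT|.-primitive_root (z%:P : {poly algC}).
  by rewrite (fmorph_primitive_root polyC).
have N0 : #|gT|%:R != 0 :> {poly algC}.
  by rewrite -polyC_natr polyC_eq0 pnatr_eq0 -lt0n (prim_order_gt0 zN).
have [lam _ lamP] := cyclic_log gen (erefl #|gT|).
rewrite (fdet_circulant_fourier gen (erefl _) zN' N0 b lamP).
apply: eq_bigr => i _; apply: eq_fdet => -[v q] [w q'].
(* Each coefficient is supported at one group element, so its Fourier sum has one term, and any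
   exponent of that element may be used. *)
have sumh h0 k (y : {poly algC}) : (g0 ^+ k)%g = h0 ->
    \sum_h y * (h == h0)%:R * (z%:P ^+ i) ^+ lam h = y * (z%:P ^+ i) ^+ k.
  move=> h0E; rewrite (bigD1 h0) //= eqxx mulr1 big1 ?addr0 => [|h hh0]; last first.
    by rewrite (negPf hh0) mulr0 mul0r.
  congr (_ * _); rewrite exprAC [RHS]exprAC; congr (_ ^+ _).
  by apply: (expg_expr_eq gen (erefl _) zN'); rewrite lamP.
rewrite /b /=; under eq_bigr => h _ do rewrite mulrDl mulr_suml.
rewrite big_split /= exchange_big /=; congr (_ + _).
  under eq_bigr => h _ do rewrite mulrAC.
  by rewrite -mulr_suml (@sumh 1%g 0%N) ?expg0 // mulr1.
rewrite rmorph_sum; apply: eq_bigr => e _.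
under eq_bigr => h _ do rewrite mulrBl.
rewrite sumrB (@sumh (g0 ^+ a e)%g (a e)) // (@sumh 1%g 0%N) ?expg0 // mulr1.
by rewrite rmorphB rmorphM !rmorphXn /= !rmorph_nat.
Qed.

End DerivedLaplacian.

(** For [l * n = l^(m+1)] the multiples of [l] index the roots of unity of the level below, the
    others those of exact order [l^(m+1)]. It serves for products and for counting. *)
Lemma big_ord_dvd (R : Type) (idx : R) (op : Monoid.com_law idx) (l n : nat)
    (F : nat -> R) : (0 < l)%N ->
  \big[op/idx]_(i < l * n) F i
  = op (\big[op/idx]_(j < n) F (l * j)%N)
       (\big[op/idx]_(i < l * n | ~~ (l %| i)%N) F i).
Proof.
move=> l0; rewrite (bigID (fun i : 'I_(l * n) => (l %| i)%N)) /=; congr (op _ _).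
have lt (j : 'I_n) : (l * j < l * n)%N by rewrite ltn_pmul2l.
rewrite (reindex_omap (fun j => Ordinal (lt j)) (fun i => insub (i %/ l)%N)) /=.
  apply: eq_bigl => j; rewrite dvdn_mulr //= mulKn // insubT //= => jn.
  by apply/eqP; congr Some; apply: val_inj.
move=> i li; have lt' : (i %/ l < n)%N by rewrite ltn_divLR // [(n * l)%N]mulnC.
by rewrite insubT /=; congr Some; apply: val_inj => /=; rewrite mulnC divnK.
Qed.

Section TowerStep.
Variables (X : graph) (S : orientation X) (Q gT gT' : finGroupType) (l : nat).
Variables (c : edge X -> (Q * gT)%type) (c' : edge X -> (Q * gT')%type).
Variables (p : edge X -> Q) (a : edge X -> nat) (g0 : gT) (g0' : gT').
Hypotheses (l_gt0 : (0 < l)%N) (card_gT : #|gT| = (l * #|gT'|)%N).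
Hypotheses (gen : [set: gT]%SET = <[g0]>%g) (gen' : [set: gT']%SET = <[g0']>%g).
Hypotheses (voltE : forall e, voltage S c e = (p e, g0 ^+ a e)%g).
Hypotheses (voltE' : forall e, voltage S c' e = (p e, g0' ^+ a e)%g).
Hypothesis X_gt0 : (0 < #|vert X|)%N.

(** The same exponents [a] describe both levels, so the Fourier factors at multiples of [l] form the
    polynomial of the lower level, with root [z ^+ l]. Its constant term vanishes, hence in degree
    one the remaining factors enter through their constant terms only. *)
Lemma num_spanning_trees_step (z : algC) : #|gT|.-primitive_root z ->
  (l * num_spanning_trees (derived S c))%N%:R =
  (num_spanning_trees (derived S c'))%:R *
    \prod_(i < #|gT| | ~~ (l %| i)%N) (map_poly intr (twisted_det p a)).[z ^+ i].
Proof.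
move=> zN; have gT'0 : (0 < #|gT'|)%N by rewrite -cardsT cardG_gt0.
have zN' : #|gT'|.-primitive_root (z ^+ l).
  have := exp_prim_root zN l.
  by rewrite (gcdn_idPl _) card_gT ?dvdn_mulr // mulKn.
have E := laplacian_charpoly_derived gen voltE zN.
have E' := laplacian_charpoly_derived gen' voltE' zN'.
pose G (i : nat) := fdet (fun u w : vert X * Q =>
    (u == w)%:R * 'X + (twisted_laplacian p a (z ^+ i) u w)%:P).
have := matrix_tree (derived S c); have := matrix_tree (derived S c').
have A0 : (laplacian_charpoly (derived S c'))`_0 = 0.
  apply: laplacian_charpoly0; rewrite !card_prod !muln_gt0 X_gt0 gT'0 andbT /=.
  by rewrite -cardsT cardG_gt0.
have prodE : map_poly intr (laplacian_charpoly (derived S c)) =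
    map_poly intr (laplacian_charpoly (derived S c')) *
    \prod_(i < #|gT| | ~~ (l %| i)%N) G i.
  rewrite E E' card_gT (big_ord_dvd _ _ G) //; congr (_ * _).
  by apply: eq_bigr => i _; rewrite /G exprM.
have := congr1 (coefp 1) prodE; rewrite /= coefM !big_ord_recl big_ord0 /=.
rewrite !coef_map /= A0 !mul0r add0r addr0 subnn => Eq M' M; move: Eq.
have -> : (\prod_(i < #|gT| | ~~ (l %| i)%N) G i)`_0 =
    \prod_(i < #|gT| | ~~ (l %| i)%N) (map_poly intr (twisted_det p a)).[z ^+ i].
  rewrite -horner_coef0 horner_prod; apply: eq_bigr => i _.
  rewrite -fdet_twisted_laplacian /G -/(horner_eval 0 _) -fdet_map; apply: eq_fdet => u w.
  by rewrite /= /horner_eval hornerD hornerMX mulr0 add0r hornerC.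
(* The numbers of vertices differ by the factor [l], which stays on the left. *)
rewrite M M' !card_prod card_gT !mulrz_nat.
set D := \prod_(_ < _ | _) _; pose m := (#|vert X| * (#|Q| * #|gT'|))%N.
have m0 : m%:R != 0 :> algC.
  by rewrite pnatr_eq0 -lt0n !muln_gt0 X_gt0 gT'0 -cardsT cardG_gt0.
rewrite -/m (_ : (_ * _ * num_spanning_trees (derived S c))%N =
  (m * (l * num_spanning_trees (derived S c)))%N); last by rewrite /m; ring.
by move=> E1; apply: (mulfI m0); rewrite -natrM mulrA -natrM.
Qed.

End TowerStep.

(** * Valuation of a norm from a cyclotomic field *)

Section ModL.
Variables (X : graph) (Q : finGroupType) (p : edge X -> Q) (a : edge X -> nat).

(** The augmentation of the twisted Laplacian: its entries are summed over [Q]. *)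
Definition weighted_det : {poly int} := fdet (fun v w : vert X =>
  \sum_(e in star v) ((v == w)%:R - (tgt e == w)%:R * 'X ^+ a e)).

Lemma twisted_det_mod (l k : nat) : prime l -> #|Q| = (l ^ k)%N ->
  map_poly intr (twisted_det p a) =
    (map_poly intr weighted_det) ^+ #|Q| :> {poly 'F_l}.
Proof.
move=> pl cardQ; have chl : l \in [pchar {poly 'F_l}] by rewrite pchar_poly pchar_Fp.
rewrite -!fdet_map.
pose b (v w : vert X) (h : Q) : {poly 'F_l} := \sum_(e in star v)
  ((v == w)%:R * (h == 1%g)%:R - (tgt e == w)%:R * (h == p e)%:R * 'X ^+ a e).
rewrite (eq_fdet (G := fun x y => b x.1 y.1 (x.2^-1 * y.2)%g)); last first.
  move=> [v q] [w q']; rewrite twisted_laplacian_map /= map_polyX /b.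
  apply: eq_bigr => e _; rewrite !xpair_eqE -!natrM !mulnb /=.
  rewrite -[(q^-1 * q')%g == 1%g](inj_eq (mulgI q)) mulg1 mulKVg.
  rewrite -[(q^-1 * q')%g == _](inj_eq (mulgI q)) mulKVg [q' == q]eq_sym.
  by rewrite [q' == _]eq_sym.
rewrite (fdet_circulant_pchar chl cardQ); congr (_ ^+ _); apply: eq_fdet => v w.
rewrite /b exchange_big rmorph_sum; apply: eq_bigr => e _.
rewrite sumrB rmorphB rmorphM rmorphXn /= map_polyX !rmorph_nat.
have sum1 h0 : \sum_h (h == h0)%:R = 1 :> {poly 'F_l}.
  rewrite (bigD1 h0) //= eqxx big1 ?addr0 // => h hh0.
  by rewrite (negPf hh0).
congr (_ - _); first by rewrite -big_distrr /= sum1 mulr1.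
by rewrite -mulr_suml -big_distrr /= sum1 mulr1.
Qed.

End ModL.

Section ModLift.
Variable l : nat.
Hypothesis l_prime : prime l.

Lemma intr_Fp_eq0 (x : int) : (x%:~R == 0 :> 'F_l) = (l %| x)%Z.
Proof. by rewrite -(dvdz_pcharf (pchar_Fp l_prime)). Qed.

Lemma poly_lift_zero (f : {poly int}) : map_poly intr f = 0 :> {poly 'F_l} ->
  exists g, f = l%:Z *: g.
Proof.
move=> f0; exists (map_poly (fun x => (x %/ l%:Z)%Z) f).
apply/polyP=> i; rewrite coefZ coef_map_id0 ?div0z // mulrC divzK //.
by rewrite -intr_Fp_eq0 -coef_map f0 coef0.
Qed.

Lemma poly_lift (f : {poly 'F_l}) : exists g : {poly int}, map_poly intr g = f.
Proof.
exists (map_poly (fun x : 'F_l => (x : nat)%:Z) f); apply/polyP=> i.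
by rewrite coef_map coef_map_id0 //= -pmulrn natr_Zp.
Qed.

Lemma horner_Aint (f : {poly int}) (x : algC) : x \in Aint ->
  (map_poly intr f).[x] \in Aint.
Proof.
move=> xA; apply: rpred_horner => //; apply/polyOverP=> i.
by rewrite coef_map rpred_int.
Qed.

End ModLift.

Section Roots.
Variables (l n : nat) (z : algC).
Hypotheses (l_prime : prime l) (zN : (l ^ n.+1).-primitive_root z).
Local Notation N := (l ^ n.+1)%N.
Local Notation phi := #|[pred i : 'I_N | ~~ (l %| i)%N]|.

Lemma card_prim_exponents : phi = (l ^ n * l.-1)%N.
Proof.
have l0 := prime_gt0 l_prime.
have := @big_ord_dvd _ _ addn l (l ^ n) (fun=> 1%N) l0.
rewrite !sum1_card !card_ord -expnS => E.
by apply/eqP; rewrite -(eqn_add2l (l ^ n)) -E -mulnS prednK // expnSr.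
Qed.

(** The value at 1 of the cyclotomic polynomial, which is a sum of [l] powers of ['X^(l ^ n)]. *)
Lemma prod_one_sub_prim : \prod_(i < N | ~~ (l %| i)%N) (1 - z ^+ i) = l%:R.
Proof.
have l0 := prime_gt0 l_prime.
have zl : (l ^ n).-primitive_root (z ^+ l).
  have := exp_prim_root zN l.
  by rewrite (gcdn_idPl _) expnS ?dvdn_mulr // mulKn.
have E := factor_Xn_sub_1 zN; have E' := factor_Xn_sub_1 zl.
rewrite big_mkord in E; rewrite big_mkord in E'.
have Xn0 : 'X^(l ^ n) - 1 != 0 :> {poly algC}.
  by rewrite -E' monic_neq0 // monic_prod_XsubC.
have Psi : \prod_(i < N | ~~ (l %| i)%N) ('X - (z ^+ i)%:P) = \sum_(k < l) 'X^(l ^ n) ^+ k.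
  apply: (mulfI Xn0); rewrite -subrX1 -exprM -expnSr -E expnS.
  rewrite (big_ord_dvd _ _ (fun i => 'X - (z ^+ i)%:P)) //= -E'; congr (_ * _).
  by apply: eq_bigr => i _; rewrite exprM.
have := congr1 (horner_eval 1) Psi; rewrite /horner_eval horner_prod horner_sum.
under eq_bigr => i _ do rewrite hornerXsubC.
move=> ->; under eq_bigr => i _ do rewrite -exprM hornerXn expr1n.
by rewrite sumr_const card_ord.
Qed.

Lemma prim_root_Aint i : z ^+ i \in Aint.
Proof. by apply: rpredX; exact: Aint_prim_root zN. Qed.

(** [z ^+ i] is again primitive, so [z ^+ j] is a power of it and the quotient is a geometric
    sum. *)
Lemma one_sub_prim_dvd (i : nat) j : ~~ (l %| i)%N ->
  exists2 y, y \in Aint & 1 - z ^+ j = (1 - z ^+ i) * y.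
Proof.
move=> li; have cop : coprime i N by rewrite coprime_sym coprime_pexpl // prime_coprime.
have [k kE] : exists k, z ^+ j = (z ^+ i) ^+ k.
  have /prim_rootP zi : N.-primitive_root (z ^+ i) by rewrite prim_root_exp_coprime.
  have [|k ->] := zi (z ^+ j); last by exists k.
  by rewrite exprAC (prim_expr_order zN) expr1n.
exists (\sum_(t < k) (z ^+ i) ^+ t); last first.
  by rewrite kE -opprB subrX1 -mulNr opprB.
by apply: rpred_sum => t _; rewrite -exprM prim_root_Aint.
Qed.

(** [l] is a product of [phi] factors [1 - z ^+ j], each a multiple of [1 - z ^+ i]. *)
Lemma prime_dvd_one_sub_prim (i r : nat) : ~~ (l %| i)%N -> (r <= phi)%N ->
  exists2 y, y \in Aint & l%:R = (1 - z ^+ i) ^+ r * y.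
Proof.
move=> li rphi.
suff [y yA yE] : exists2 y, y \in Aint & l%:R = (1 - z ^+ i) ^+ phi * y.
  exists ((1 - z ^+ i) ^+ (phi - r) * y); last by rewrite mulrA -exprD subnKC.
  by rewrite rpredM ?rpredX ?rpredB ?rpred1 ?prim_root_Aint.
have [y yA yE] : exists2 y : 'I_N -> algC, forall j, y j \in Aint &
    forall j : 'I_N, 1 - z ^+ j = (1 - z ^+ i) * y j.
  have H j := one_sub_prim_dvd j li.
  by exists (fun j : 'I_N => s2val (cid2 (H j))) => j; case: cid2.
exists (\prod_(j < N | ~~ (l %| j)%N) y j); first by apply: rpred_prod => j _.
by rewrite -prod_one_sub_prim -prodr_const -big_split /=; apply: eq_bigr.
Qed.
(** Evaluate [(X - 1)^N = X^N - 1] modulo [l] at [z]. This turns divisibility of an integer by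
    [1 - z] into divisibility of its [N]-th power by [l]. *)
Lemma one_sub_prim_exp : exists2 y, y \in Aint & (1 - z) ^+ N = l%:R * y.
Proof.
have chl : l \in [pchar {poly 'F_l}] by rewrite pchar_poly pchar_Fp.
have [g gE] : exists g, ('X - 1) ^+ N - ('X^N - 1) = l%:Z *: g :> {poly int}.
  apply: poly_lift_zero => //; rewrite !(rmorphB, rmorphXn, rmorph1) /= map_polyX.
  have lN : [pchar {poly 'F_l}].-nat N by rewrite pnatX pnatE ?chl.
  have := exprDn_pchar ('X - 1) 1 lN.
  by rewrite subrK expr1n => ->; rewrite addrK subrr.
exists ((-1) ^+ N * (map_poly intr g).[z]).
  by rewrite rpredM ?rpredX ?rpredN ?rpred1 ?horner_Aint ?(Aint_prim_root zN).
have E : (z - 1) ^+ N = l%:R * (map_poly intr g).[z].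
  have := congr1 (fun p => (map_poly intr p).[z]) gE.
  rewrite linearZ /= !(rmorphB, rmorphXn, rmorph1) /= map_polyX hornerZ !hornerE.
  by rewrite (prim_expr_order zN) subrr subr0.
by rewrite -opprB [LHS]exprNn E mulrCA.
Qed.

Lemma Aint_int_dvd (x : int) (k : nat) (y : algC) : (0 < k)%N -> y \in Aint ->
  x%:~R = k%:R * y -> (k %| x)%Z.
Proof.
move=> k0 yA xE; have k0' : k%:R != 0 :> algC by rewrite pnatr_eq0 -lt0n.
have yE : y = x%:~R / k%:R by rewrite xE mulrC mulKf.
have /Cint_rat_Aint/(_ yA)/intrP[c cE] : y \in Crat by rewrite yE rpred_div ?rpred_int ?rpred_nat.
apply/dvdzP; exists c; apply: (@intr_inj algC).
by rewrite xE cE rmorphM /= mulrC.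
Qed.

(** Write [f = (1 - X)^r U + l g] over the integers. At [w = z ^+ i] the number [l] is a multiple of
    [(1 - w)^r], so [f(w) = (1 - w)^r h] with [h] an algebraic integer. The product of the [h] is
    rational, hence the natural number [c]. If [r < phi], then [l] has one more factor [1 - w], so
    each [h] is congruent to [U(1)] and [c] to [U(1)^phi] modulo [1 - z]. *)
Lemma norm_valuation (f : {poly int}) (r : nat) (u : {poly 'F_l}) (A B : nat) :
  map_poly intr f = (1 - 'X) ^+ r * u -> (r <= phi)%N -> (0 < B)%N ->
  A%:R = B%:R * \prod_(i < N | ~~ (l %| i)%N) (map_poly intr f).[z ^+ i] ->
  exists2 c, A = (B * (l ^ r * c))%N & ((r < phi)%N -> u.[1] != 0 -> ~~ (l %| c)%N).
Proof.
move=> fE rphi B0 AE; have [U UE] := poly_lift u.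
have l0 := prime_gt0 l_prime.
have [g gE] : exists g, f - (1 - 'X) ^+ r * U = l%:Z *: g.
  apply: poly_lift_zero => //.
  by rewrite !(rmorphB, rmorphM, rmorphXn, rmorph1) /= map_polyX fE UE subrr.
have [y yA yE] : exists2 y : 'I_N -> algC, forall i, y i \in Aint &
    forall i : 'I_N, ~~ (l %| i)%N -> l%:R = (1 - z ^+ i) ^+ r * y i /\
     ((r < phi)%N -> exists2 y', y' \in Aint & y i = (1 - z) * y').
  suff H (i : 'I_N) : exists yi, yi \in Aint /\ (~~ (l %| i)%N ->
      l%:R = (1 - z ^+ i) ^+ r * yi /\
      ((r < phi)%N -> exists2 y', y' \in Aint & yi = (1 - z) * y')).
    by exists (fun i => sval (cid (H i))) => i; case: cid => yi [].
  (* At multiples of [l] the value 0 is a mere default. *)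
  case li: (l %| i)%N; first by exists 0; rewrite rpred0.
  have [rlt|rge] := ltnP r phi; last first.
    by have [yi yiA yiE] := prime_dvd_one_sub_prim (negbT li) rphi; exists yi.
  have [yi yiA yiE] := prime_dvd_one_sub_prim (negbT li) rlt.
  have [t tA tE] : exists2 t, t \in Aint & 1 - z ^+ i = (1 - z ^+ 1) * t.
    by apply: one_sub_prim_dvd; rewrite Euclid_dvd1.
  exists ((1 - z ^+ i) * yi); split.
    by rewrite rpredM ?rpredB ?rpred1 ?prim_root_Aint.
  move=> _; split=> [|_]; first by rewrite mulrA -exprSr.
  by exists (t * yi); rewrite ?rpredM // tE mulrA.
pose h (i : 'I_N) := (map_poly intr U).[z ^+ i] + y i * (map_poly intr g).[z ^+ i].
have hA i : h i \in Aint.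
  by rewrite rpredD ?rpredM ?horner_Aint ?prim_root_Aint.
have fh (i : 'I_N) : ~~ (l %| i)%N -> (map_poly intr f).[z ^+ i] = (1 - z ^+ i) ^+ r * h i.
  move=> li; have [lE _] := yE i li.
  have -> : f = l%:Z *: g + (1 - 'X) ^+ r * U by rewrite -gE subrK.
  rewrite rmorphD /= map_polyZ hornerD hornerZ /= -pmulrn lE /h.
  rewrite !(rmorphB, rmorphM, rmorphXn, rmorph1) /= map_polyX !hornerE.
  by ring.
pose H := \prod_(i < N | ~~ (l %| i)%N) h i.
have HA : H \in Aint by apply: rpred_prod.
have AH : A%:R = (B * l ^ r)%N%:R * H.
  rewrite AE (eq_bigr _ fh) big_split /= prodrXl prod_one_sub_prim.
  by rewrite natrM natrX mulrA.
have Bl0 : (0 < B * l ^ r)%N by rewrite muln_gt0 B0 expn_gt0 l0.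
have HE : H = A%:R / (B * l ^ r)%N%:R.
  by rewrite AH mulrC mulKf // pnatr_eq0 -lt0n.
have /natrP[c cE] : H \is a Num.nat.
  rewrite natrEint Cint_rat_Aint // HE ?rpred_div ?rpred_nat //.
  by rewrite divr_ge0 ?ler0n.
exists c; first by apply/eqP; rewrite -(eqr_nat algC) AH cE -natrM mulnA.
move=> rlt u1; apply/negP=> /dvdnP[c' c'E].
have [t tA tE] : exists2 t, t \in Aint & H = (U.[1] ^+ phi)%:~R + (1 - z) * t.
  suff [_ [t tA tE]] : \prod_(i < N | ~~ (l %| i)%N) (U.[1])%:~R \in Aint /\
      exists2 t, t \in Aint &
      H = \prod_(i < N | ~~ (l %| i)%N) (U.[1])%:~R + (1 - z) * t.
    by exists t; rewrite // tE -prodr_const rmorph_prod.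
  rewrite /H; apply: (big_ind2 (fun x w => w \in Aint /\
    exists2 t, t \in Aint & x = w + (1 - z) * t)) => [|x1 x2 w1 w2|i li].
  - by rewrite rpred1; split=> //; exists 0; rewrite ?rpred0 // mulr0 addr0.
  - move=> [? [t1 t1A ->]] [? [t2 t2A ->]]; split; first by rewrite rpredM.
    exists (x2 * t2 + t1 * w2 + t1 * (1 - z) * t2); last by ring.
    by rewrite !rpredD ?rpredM ?rpredB ?rpred1 ?(Aint_prim_root zN).
  rewrite rpred_int; split=> //.
  have [_ /(_ rlt)[y' y'A y'E]] := yE i li.
  have [v vE] : exists v, U - (U.[1])%:P = v * ('X - 1%:P).
    by apply/factor_theorem; rewrite /root !hornerE subrr.
  have [s sA sE] : exists2 t, t \in Aint & 1 - z ^+ i = (1 - z ^+ 1) * t.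
    by apply: one_sub_prim_dvd; rewrite Euclid_dvd1.
  exists (- s * (map_poly intr v).[z ^+ i] + y' * (map_poly intr g).[z ^+ i]).
    by rewrite rpredD ?rpredM ?rpredN ?horner_Aint ?prim_root_Aint.
  have := congr1 (fun p => (map_poly intr p).[z ^+ i]) vE.
  rewrite !(rmorphB, rmorphM) /= map_polyX !map_polyC /= rmorph1 !hornerE => /eqP.
  rewrite subr_eq => /eqP vE'; rewrite /h vE' y'E -[_ - 1]opprB sE expr1; ring.
have [s sA sE] : exists2 y, y \in Aint & l%:R = (1 - z ^+ 1) ^+ 1 * y.
  by apply: prime_dvd_one_sub_prim; rewrite ?Euclid_dvd1 //; apply: leq_trans rlt.
have [y1 y1A y1E] := one_sub_prim_exp.
rewrite !expr1 in sE.
have wE : (U.[1] ^+ phi)%:~R = (1 - z) * (s * c'%:R - t).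
  have -> : (U.[1] ^+ phi)%:~R = H - (1 - z) * t by rewrite tE addrK.
  by rewrite cE c'E natrM sE; ring.
(* If [l] divides [c], then [1 - z] divides the integer [U(1)^phi]; the [N]-th power brings this
   back to [l]. *)
have : (l %| (U.[1] ^+ phi) ^+ N)%Z.
  apply: (@Aint_int_dvd _ _ (y1 * (s * c'%:R - t) ^+ N)) => //.
    by rewrite rpredM ?rpredX ?rpredB ?rpredM ?rpred_nat.
  by rewrite rmorphXn /= wE exprMn y1E mulrA.
rewrite -(intr_Fp_eq0 l_prime) !rmorphXn /= !expf_eq0 => /andP[_ /andP[_]].
by rewrite -horner_map /= rmorph1 UE (negPf u1).
Qed.

(** The multiplicity [s] of the root 1 of [f] modulo [l] is recovered from the valuation [r]: a
    factor [(1 - X)^(r+1)] would force a larger valuation, which also excludes [f = 0], and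
    [s <= r < phi] makes the valuation exactly [s]. The multiplicity for [f'] is then [e * r]. *)
Lemma norm_logn_pow (f f' : {poly int}) (e r A B A' B' : nat) :
  map_poly intr f' = (map_poly intr f) ^+ e :> {poly 'F_l} ->
  (0 < A)%N -> (0 < B)%N -> (0 < A')%N -> (0 < B')%N ->
  A%:R = B%:R * \prod_(i < N | ~~ (l %| i)%N) (map_poly intr f).[z ^+ i] ->
  A'%:R = B'%:R * \prod_(i < N | ~~ (l %| i)%N) (map_poly intr f').[z ^+ i] ->
  logn l A = (logn l B + r)%N -> (r < phi)%N -> (e * r < phi)%N ->
  logn l A' = (logn l B' + e * r)%N.
Proof.
move=> f'E A0 B0 A'0 B'0 AE A'E lognA rphi erphi; have l0 := prime_gt0 l_prime.
have logE s c C D : (0 < C)%N -> (0 < D)%N -> C = (D * (l ^ s * c))%N ->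
    logn l C = (logn l D + (s + logn l c))%N.
  move=> C0 D0 CE; have : (0 < c)%N by case: c CE => [|//]; rewrite !muln0 => C1; rewrite C1 in C0.
  by move=> c0; rewrite CE !lognM ?muln_gt0 ?expn_gt0 ?l0 ?c0 // pfactorK.
have nodiv s (u : {poly 'F_l}) : map_poly intr f = (1 - 'X) ^+ s * u -> (s <= r)%N.
  move=> fE; rewrite leqNgt; apply/negP=> rs.
  have fE' : map_poly intr f = (1 - 'X) ^+ r.+1 * ((1 - 'X) ^+ (s - r.+1) * u).
    by rewrite mulrA -exprD subnKC.
  have [c cE _] := norm_valuation fE' rphi B0 AE.
  by have := logE _ _ _ _ A0 B0 cE; rewrite lognA; lia.
have [s [q qroot fE]] := multiplicity_XsubC (map_poly intr f : {poly 'F_l}) 1.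
have {}fE : map_poly intr f = (1 - 'X) ^+ s * ((-1) ^+ s * q).
  by rewrite fE mulrA -exprMn mulrC mulrN1 opprB.
have f0 : map_poly intr f != 0 :> {poly 'F_l}.
  apply/eqP=> f0; have := nodiv r.+1 0; rewrite f0 mulr0 => /(_ erefl).
  by rewrite ltnn.
have u1 : ((-1) ^+ s * q).[1] != 0.
  move: qroot; rewrite f0 /= /root => q1.
  by rewrite hornerM horner_exp !hornerE mulf_neq0 // signr_eq0.
have sr : s = r.
  have sr := nodiv _ _ fE; have [c cE] := norm_valuation fE (ltnW (leq_ltn_trans sr rphi)) B0 AE.
  move=> /(_ (leq_ltn_trans sr rphi) u1) lc; have := logE _ _ _ _ A0 B0 cE.
  by rewrite [logn l c]lognE (negPf lc) !andbF; lia.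
have f'E' : map_poly intr f' = (1 - 'X) ^+ (e * r) * ((-1) ^+ s * q) ^+ e.
  by rewrite f'E fE exprMn -exprM sr mulnC.
have [c cE lc] := norm_valuation f'E' (ltnW erphi) B'0 A'E.
have := logE _ _ _ _ A'0 B'0 cE; rewrite [logn l c]lognE (negPf (lc erphi _)).
  by rewrite !andbF addn0.
by rewrite horner_exp expf_neq0.
Qed.

End Roots.

(** * The quotients by the lower central l-series *)

Section LowerCentralQuotients.
Local Open Scope classical_set_scope.
Local Open Scope card_scope.
Variables (G : topGroupType) (l : nat) (Q : nat -> finGroupType) (pi : forall n, G -> Q n).
Hypothesis Q_quotient : forall n, is_quotient (lcs G l n) (pi n).

Let piM n : {morph pi n : x y / (x * y)%g}. Proof. by case: (Q_quotient n). Qed.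
Let pi_surj n q : exists x, pi n x = q. Proof. by case: (Q_quotient n). Qed.
Let pi_ker n x : pi n x = 1%g <-> lcs G l n x. Proof. by case: (Q_quotient n). Qed.
Let pi1 n : pi n 1%g = 1%g.
Proof. by apply: (mulgI (pi n 1%g)); rewrite -piM !mulg1. Qed.
Let piV n x : pi n x^-1%g = (pi n x)^-1%g.
Proof. by apply: (mulgI (pi n x)); rewrite -piM !mulgV pi1. Qed.

Lemma closed_gen_sub (A N : set G) :
  subgroup N -> closed N -> A `<=` N -> closed_gen A `<=` N.
Proof.
move=> Ng Nc AN; rewrite (closure_id N).1 //; apply: closure_subset.
exact: smallest_sub.
Qed.

(** Read off from [lcs G l n] being the kernel of [pi n]. *)
Lemma lcs_subgroup n : subgroup (lcs G l n).
Proof.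
split=> [|x y /pi_ker xN /pi_ker yN|x /pi_ker xN]; apply/pi_ker.
- exact: pi1.
- by rewrite piM xN yN mulg1.
- by rewrite piV xN invg1.
Qed.

Lemma lcs_closed n : closed (lcs G l n).
Proof. by case: n => [|n] /=; [exact: closedT | exact: closed_closure]. Qed.

Lemma lcs_subset n : lcs G l n.+1 `<=` lcs G l n.
Proof.
have [N1 NM NV] := lcs_subgroup n; have Nc := @lcs_closed n.
have NX x k : lcs G l n x -> lcs G l n (x ^+ k)%g.
  by move=> Nx; elim: k => [|k IH]; rewrite ?expg0 // expgS; apply: NM.
apply: (closed_gen_sub (lcs_subgroup n) Nc) => _ [x xp [y yc <-]]; apply: NM.
  apply: (closed_gen_sub (lcs_subgroup n) Nc) xp => _ [u Nu <-]; exact: NX.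
apply: (closed_gen_sub (lcs_subgroup n) Nc) yc => _ [u Nu [v _ <-]]; apply/pi_ker.
by rewrite /commg /conjg !piM !piV (pi_ker n u).2 // invg1 !mul1g mulVg.
Qed.

(** The map [Q n.+1 -> Q n] is built from a section of [pi n.+1]. Its kernel [K] is the image of
    [lcs G l n], and the fibres of [pi n.+1] over [K] are the cosets counted by [m]. *)
Lemma card_lcs_quotient_step n m : Defs.index (lcs G l n) (lcs G l n.+1) m ->
  #|Q n.+1| = (#|Q n| * m)%N.
Proof.
move=> idx.
have pi_eq k x y : pi k x = pi k y <-> lcs G l k (x^-1 * y)%g.
  rewrite -pi_ker piM piV; split=> [->|]; first by rewrite mulVg.
  by move/(congr1 (mulg (pi k x))); rewrite mulKVg mulg1.
pose sec (q : Q n.+1) := sval (cid (pi_surj q)).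
have secK q : pi n.+1 (sec q) = q by rewrite /sec; case: cid.
pose f q := pi n (sec q).
have fE x : f (pi n.+1 x) = pi n x.
  by apply/pi_eq/lcs_subset/pi_eq; rewrite secK.
have fM : {in [set: Q n.+1]%SET &, {morph f : x y / (x * y)%g}}.
  by move=> x y _ _; rewrite -(secK x) -(secK y) -piM !fE piM.
pose fm := Morphism fM; pose K := 'ker fm.
have im_f : [set: Q n]%SET \subset fm @* [set: Q n.+1]%SET.
  apply/fintype.subsetP=> q _; have [x <-] := pi_surj q.
  by rewrite -fE; apply: (mem_morphim fm); rewrite inE.
have := @card_morphpre _ _ _ fm [set: Q n]%G im_f.
have -> : fm @*^-1 [set: Q n]%G = [set: Q n.+1]%SET.
  by apply/setP=> q; rewrite !inE.
rewrite !cardsT => ->; rewrite mulnC; congr (_ * _)%N.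
pose F (j : nat) : set G := [set x | pi n.+1 x = nth 1%g (enum K) j].
have FI : F @` `I_#|K| = cosets (lcs G l n) (lcs G l n.+1).
  apply/seteqP; split=> [_ [j jK <-]|_ [x xN <-]].
    have [x xE] := pi_surj (nth 1%g (enum K) j); exists x.
      apply/pi_ker; rewrite -fE xE; apply: (mker (f := fm)).
      by rewrite -mem_enum mem_nth // -cardE.
    apply/seteqP; split=> [_ [h hN <-]|y yE]; rewrite /F /=.
      by rewrite -xE piM (pi_ker _ h).2 // mulg1.
    by exists (x^-1 * y)%g; [apply: (pi_eq n.+1 x y).1; rewrite xE yE | rewrite mulKVg].
  have xK : pi n.+1 x \in enum K.
    by rewrite mem_enum; apply/kerP; rewrite ?inE //= fE; apply/pi_ker.
  exists (seq.index (pi n.+1 x) (enum K)); first by rewrite /= cardE index_mem.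
  apply/seteqP; split=> [y|_ [h hN <-]]; rewrite /F /= nth_index //.
    by move=> yE; exists (x^-1 * y)%g; [apply: (pi_eq n.+1 x y).1 | rewrite mulKVg].
  by rewrite piM (pi_ker _ h).2 // mulg1.
have Finj : {in `I_#|K| &, injective F}.
  move=> i j; rewrite !inE /= => iK jK /seteqP[+ _].
  have [x xE] := pi_surj (nth 1%g (enum K) i).
  move=> /(_ x xE); rewrite /F /= xE => /eqP.
  by rewrite nth_uniq -?cardE ?enum_uniq // => /eqP.
apply/card_eq_II; apply: card_eq_trans idx; rewrite -FI card_eq_sym.
exact: inj_card_eq.
Qed.

Lemma card_lcs_quotient d : uniform_dim G l d -> forall n, #|Q n| = (l ^ (d * n))%N.
Proof.
move=> [[_ _ idx] _ idx0]; elim=> [|n IH].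
  rewrite muln0 expn0; apply/eqP/fintype1P; exists 1%g => q.
  by have [x <-] := pi_surj q; apply/pi_ker.
rewrite (@card_lcs_quotient_step n (l ^ d)) ?IH -?expnD ?mulnS 1?addnC //.
(* Uniformity compares the indices from [n = 1] on; at [n = 0] the index is the one defining [d]. *)
case: n {IH} => [//|n]; exact: card_eq_trans (idx _ _) idx0.
Qed.

End LowerCentralQuotients.

(** * The Galois groups of the tower *)

(** A path from [(v0, 1)] to [(v0, h)] writes [h] as a product of voltages. *)
Lemma derived_connected_ind (X : graph) (S : orientation X) (H : finGroupType)
    (c : edge X -> H) (P : H -> Prop) : connected_graph (derived S c) ->
  P 1%g -> (forall h e, P h -> P (h * voltage S c e)%g) -> forall h, P h.
Proof.
move=> [/card_gt0P[[v0 _] _] con] P1 PM h.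
have /connectP[p] := con (v0, 1%g) (v0, h).
suff: forall (y : vert (derived S c)) q, path (adj [set: edge (derived S c)]%SET) y q ->
    P y.2 -> P (last y q).2.
  by move=> H0 pp E; have := H0 _ _ pp P1; rewrite -E.
move=> y q; elim: q y => //= w q IH y /andP[/exists_inP[e _ /andP[/eqP oe /eqP te]] pq] Py.
apply: IH pq _; rewrite -te /=; apply: PM.
by rewrite -oe in Py.
Qed.

Lemma cover_surj (Y X : graph) (f : ghom Y X) : Defs.cover f ->
  (forall v, exists w, vmap f w = v) /\ (forall e, exists e', emap f e' = e).
Proof.
move=> [fv fe]; split=> // e; have [w we] := fv (org e); have [_ E] := fe w.
have : e \in star (vmap f w) by rewrite inE we.
by rewrite -E => /imsetP[e' _ ->]; exists e'.
Qed.

Section Restriction.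
Variables (l : nat) (X_ : nat -> graph) (f_ : forall m, ghom (X_ m.+1) (X_ m)).
Hypotheses (l_prime : prime l) (X_tower : Zl_tower f_ l).
Variables (S : orientation (X_ 0)) (beta : edge (X_ 0) -> tower_gal_lim f_).
Local Notation Gam m := (subg_of (tower_gal f_ m)).

Let res m (s : Gam m.+1) (t : Gam m) := restricts_to (f_ m) (sgval s) (sgval t).

Let res1 m : res (1%g : Gam m.+1) 1%g.
Proof. by split=> x; rewrite !perm1. Qed.

Let resM m (s s' : Gam m.+1) (t t' : Gam m) :
  res s t -> res s' t' -> res (s * s')%g (t * t')%g.
Proof. by move=> [sv se] [sv' se']; split=> x; rewrite !permM ?sv' ?se' ?sv ?se. Qed.

Let res_fun m (s : Gam m.+1) (t t' : Gam m) : res s t -> res s t' -> t = t'.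
Proof.
move=> [sv se] [sv' se']; case: X_tower => _ /(_ m)/cover_surj[fv fe] _.
apply: val_inj; rewrite [LHS]surjective_pairing [RHS]surjective_pairing.
congr (_, _); apply/permP=> x.
  by have [w <-] := fv x; rewrite -sv -sv'.
by have [w <-] := fe x; rewrite -se -se'.
Qed.

Let resV m (s : Gam m.+1) (t : Gam m) : res s t -> res s^-1%g t^-1%g.
Proof.
move=> [sv se]; split=> x.
  by rewrite -[x in RHS](permKV (sgval s).1) sv permK.
by rewrite -[x in RHS](permKV (sgval s).2) se permK.
Qed.

Let res_voltage m e : res (voltage S (fun s => lim_proj (beta s) m.+1) e)
                          (voltage S (fun s => lim_proj (beta s) m) e).
Proof.
by rewrite /voltage; case: ifP => _; [|apply: resV]; exact: lim_projP.
Qed.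

Lemma card_tower_gal m : (0 < m)%N -> #|Gam m| = (l ^ m)%N.
Proof.
move=> m0; have [_ _ /(_ m m0)[_ iso]] := X_tower.
rewrite card_sub; have -> : #|[pred x | x \in tower_gal f_ m]| = #|tower_gal f_ m| by [].
by rewrite (card_isog iso) card_Zp // expn_gt0 prime_gt0.
Qed.

(** Restriction to the level below is given as a relation. Voltages restrict to voltages and, by
    connectedness, generate both groups, so the relation is total and surjective. The restriction
    [t] of a generator [s] is then a generator, and exponents with respect to [s] are exponents with
    respect to [t]. *)
Lemma tower_gal_generators m (Q : finGroupType) (q : edge (X_ 0) -> Q) :
    (0 < m)%N ->
    connected_graph (derived S (fun e => (q e, lim_proj (beta e) m))) ->
    connected_graph (derived S (fun e => (q e, lim_proj (beta e) m.+1))) ->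
  exists (s : Gam m.+1) (t : Gam m) (a : edge (X_ 0) -> nat),
    [/\ [set: Gam m.+1]%SET = <[s]>%g, [set: Gam m]%SET = <[t]>%g,
      forall e, voltage S (fun e => lim_proj (beta e) m.+1) e = (s ^+ a e)%g
    & forall e, voltage S (fun e => lim_proj (beta e) m) e = (t ^+ a e)%g].
Proof.
move=> m0 con con'.
have volt2 k e : (voltage S (fun e => (q e, lim_proj (beta e) k)) e).2 =
    voltage S (fun e => lim_proj (beta e) k) e.
  by rewrite /voltage; case: ifP.
have res_surj (t : Gam m) : exists s, res s t.
  apply: (derived_connected_ind (P := fun h => exists s, res s h.2) con _ _ (1%g, t)).
    by exists 1%g; exact: res1.
  move=> h e [s st]; exists (s * voltage S (fun e => lim_proj (beta e) m.+1) e)%g.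
  by rewrite /= volt2; apply: resM.
have res_total (s : Gam m.+1) : exists t, res s t.
  apply: (derived_connected_ind (P := fun h => exists t, res h.2 t) con' _ _ (1%g, s)).
    by exists 1%g; exact: res1.
  move=> h e [t st]; exists (t * voltage S (fun e => lim_proj (beta e) m) e)%g.
  by rewrite /= volt2; apply: resM.
have [_ _ /(_ m.+1 isT)[_ iso]] := X_tower.
have /cyclicP[s sE] : cyclic [set: Gam m.+1]%SET.
  have := isog_cyclic (isog_trans (isog_symr (isog_subg (tower_gal f_ m.+1))) iso).
  rewrite /= => ->; rewrite /Zp; case: ifP => _; last exact: cyclic1.
  by rewrite Zp_cycle cycle_cyclic.
have [t st] := res_total s.
have resX k : res (s ^+ k)%g (t ^+ k)%g.
  by elim: k => [|k IH]; [exact: res1 | rewrite !expgS; apply: resM].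
have [lam _ lamP] := cyclic_log sE (erefl _).
exists s, t, (fun e => lam (voltage S (fun e => lim_proj (beta e) m.+1) e)).
split=> // [|e].
  apply/setP=> u; rewrite inE; have [s' s'u] := res_surj u.
  suff -> : u = (t ^+ lam s')%g by rewrite mem_cycle.
  by apply: (res_fun s'u); rewrite -{1}(lamP s'); exact: resX.
apply: (@res_fun _ (voltage S (fun e => lim_proj (beta e) m.+1) e)) => //.
by rewrite -{1}(lamP (voltage _ _ _)); exact: resX.
Qed.

End Restriction.

(** * Comparison of the growth over [Y n] with the growth over [Y 0] *)

Lemma voltage_pair (X : graph) (S : orientation X) (H K : groupType)
    (c : edge X -> H) (c' : edge X -> K) e :
  voltage S (fun e => (c e, c' e)) e = (voltage S c e, voltage S c' e).
Proof. by rewrite /voltage; case: ifP. Qed.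

Lemma iwasawa_invariants_step (l : nat) (X_ : nat -> graph) (lam n0 : nat) :
  (forall m, (n0 <= m)%N -> logn l (num_spanning_trees (X_ m.+1)) =
     (logn l (num_spanning_trees (X_ m)) + lam)%N) ->
  iwasawa_invariants l X_ 0 lam.
Proof.
move=> step; exists ((logn l (num_spanning_trees (X_ n0)))%:Z - (lam * n0)%N%:Z), n0.
move=> m /subnKC <-; elim: (m - n0)%N => [|k IH]; first by rewrite addn0; lia.
by rewrite addnS step ?leq_addr //; lia.
Qed.

Theorem theorem5p2
  (l : nat) (l_prime : prime l)
  (* the base graph X is X_ 0 *)
  (X_ : nat -> graph) (f_ : forall m, ghom (X_ m.+1) (X_ m))
  (X_connected : connected_graph (X_ 0))
  (X_tower : Zl_tower f_ l)
  (t : nat) (S : orientation (X_ 0)) (s : 'I_t -> edge (X_ 0))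
  (s_inj : injective s) (S_eq : orient S = [set s i | i : 'I_t]%SET)
  (G : topGroupType) (G_infinite : infinite_set [set: G]%classic)
  (G_pro : pro G l)
  (Q : nat -> finGroupType) (pi : forall n, G -> Q n)
  (Q_quotient : forall n, is_quotient (lcs G l n) (pi n))
  (k : nat) (le_kt : (k <= t)%N) (g : 'I_k -> G)
  (g_gen : topologically_generates (range g))
  (alpha : edge (X_ 0) -> G)
  (alpha_g : forall i : 'I_k, alpha (s (widen_ord le_kt i)) = g i)
  (beta : edge (X_ 0) -> tower_gal_lim f_)
  (X_beta : tower_of_voltage S beta) :
  let Y n m := derived S (H := (Q n * [subg tower_gal f_ m])%type)
                 (fun e => (pi n (alpha e), lim_proj (beta e) m)) in
  forall (d : nat) (G_uniform : uniform_dim G l d)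
    (Y_connected : forall n m, connected_graph (Y n m))
    (mu0 lambda : nat) (Y0_inv : iwasawa_invariants l (Y 0%N) mu0 lambda)
    (mu0_eq0 : mu0 = 0%N),
  forall n, iwasawa_invariants l (Y n) 0 (l ^ (d * n) * (lambda + 1) - 1)%N.
Proof.
move=> Y d G_uniform Y_connected mu0 lambda [nu [n0 Y0_inv]] mu0_eq0 n.
have cardQ := card_lcs_quotient Q_quotient G_uniform.
have l0 := prime_gt0 l_prime; have l1 := prime_gt1 l_prime.
have K0 n' m : (0 < num_spanning_trees (Y n' m))%N.
  exact: num_spanning_trees_gt0 (Y_connected n' m).
have e0 : (0 < l ^ (d * n))%N by rewrite expn_gt0 l0.
(* From [n0] on the growth for [n = 0] is known; from [e * (lambda + 1)] on there are more primitive
   roots than either multiplicity, as [m < l ^ m]. *)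
pose e := (l ^ (d * n))%N; pose M := (n0 + e * (lambda + 1)).+1.
apply: (@iwasawa_invariants_step _ _ _ M) => m Mm.
have m0 : (0 < m)%N by apply: leq_trans Mm.
(* The exponents [a] are obtained from [Y 0] and used for [Y n] too, so both determinants reduce to
   powers of the same [weighted_det a]. *)
have [s0 [t0 [a [gen gen' volt volt']]]] :=
  tower_gal_generators X_tower m0 (Y_connected 0%N m) (Y_connected 0%N m.+1).
have cardG := card_tower_gal l_prime X_tower m0.
have cardG' := card_tower_gal l_prime X_tower (ltn0Sn m).
have lm0 : (0 < l ^ m.+1)%N by rewrite expn_gt0 l0.
have [z zN] := C_prim_root_exists lm0.
have phiE := card_prim_exponents m l_prime.
have phi_gt : (n0 + e * (lambda + 1) < l ^ m * l.-1)%N.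
  apply: leq_trans (leq_pmulr _ _); last by rewrite -ltnS prednK.
  by apply: leq_trans (ltnW (ltn_expl m l1)).
have X0 : (0 < #|vert (X_ 0%N)|)%N by case: X_connected.
pose p n' := voltage S (fun e => pi n' (alpha e)).
have step n' : (l * num_spanning_trees (Y n' m.+1))%N%:R =
    (num_spanning_trees (Y n' m))%:R *
    \prod_(i < l ^ m.+1 | ~~ (l %| i)%N) (map_poly intr (twisted_det (p n') a)).[z ^+ i] :> algC.
  rewrite -cardG'; apply: (num_spanning_trees_step (g0 := s0) (g0' := t0)) => //.
  - by rewrite cardG' cardG expnS.
  - by move=> e'; rewrite voltage_pair volt.
  - by move=> e'; rewrite voltage_pair volt'.
  - by rewrite cardG'.
have detE n' : map_poly intr (twisted_det (p n') a) =
    map_poly intr (weighted_det a) ^+ #|Q n'| :> {poly 'F_l}.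
  exact: twisted_det_mod (cardQ n').
have logl (c : nat) : (0 < c)%N -> logn l (l * c) = (logn l c).+1.
  by move=> c0; rewrite lognM // logn_prime // eqxx.
have lK0 n' : (0 < l * num_spanning_trees (Y n' m.+1))%N by rewrite muln_gt0 l0 K0.
have log0 : logn l (l * num_spanning_trees (Y 0%N m.+1)) =
    (logn l (num_spanning_trees (Y 0%N m)) + (lambda + 1))%N.
  rewrite logl //; have n0m : (n0 <= m)%N by apply: leq_trans Mm; rewrite /M; lia.
  have := Y0_inv m n0m; have := Y0_inv m.+1 (leqW n0m); rewrite mu0_eq0; lia.
have det_pow : map_poly intr (twisted_det (p n) a) =
    map_poly intr (twisted_det (p 0%N) a) ^+ e :> {poly 'F_l}.
  by rewrite !detE !cardQ muln0 expn0 expr1.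
have := norm_logn_pow l_prime zN det_pow (lK0 0%N) (K0 0%N m) (lK0 n) (K0 n m)
  (step 0%N) (step n) log0.
(* Taking the factor [l] off again gives the [- 1]; the truncated subtraction is exact because [e]
   is positive. *)
rewrite phiE => /(_ _ _); rewrite logl // => H.
have := H _ _; rewrite /e; nia.
Qed.
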